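(* Let $A>1$. Let $M\ge 2$ and $n$ be two integers such that $\log M\le 16(\min(1,A-1))^2 n$. The sequence $$\psi_n(M)=\frac{\log M}{n}$$ is an optimal rate of aggregation of $M$ functions in $(\mathcal{F}_K(A),\mathcal{F}(A))$ with respect to the Kullback-Leibler divergence loss (in the sense of the definition given in the context). Moreover, the aggregation procedure with exponential weights $\tilde f_n$ (defined in the context) achieves this rate. So this procedure is an optimal aggregation procedure with respect to the Kullback-Leibler loss.
   Context: Setting: $X_1,\dots,X_n$ are i.i.d. observations in $\mathcal{X}=\mathbb{R}^d$ drawn from an unknown probability with density $f$ with respect to $\nu$, the Lebesgue measure on $\mathbb{R}^d$; $\mathbb{E}_f$ is the expectation when the true density is $f$. An estimator is a function built from the sample $X_1,\dots,X_n$. Both $\mathcal{F}(A)$ (the class of densities to be estimated) and $\mathcal{F}_K(A)$ (the class of functions to be aggregated) denote the set of densities bounded by $A$. Kullback-Leibler divergence: for densities $f,g$ with associated probability distributions $P_f,P_g$, $K(f|g)=\int_{\mathcal{X}}\log(f/g)\,f\,d\nu$ if $P_f\ll P_g$, and $K(f|g)=+\infty$ otherwise. Definition (optimal rate of aggregation). Let $M\ge2$ be an integer, $\mathcal{F}$ a set of densities on $\mathcal{X}$, $\mathcal{F}_0$ a set of real-valued functions on $\mathcal{X}$ with $\mathcal{F}\subseteq\mathcal{F}_0$, and $\ell$ a loss function on $\mathcal{F}_0$. A sequence of positive numbers $(\psi_n(M))_{n\in\mathbb{N}^*}$ is called an optimal rate of aggregation of $M$ functions in $(\mathcal{F}_0,\mathcal{F})$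 with respect to the loss $\ell$ if: (i) There exists a constant $C<\infty$, depending only on $\mathcal{F}_0$, $\mathcal{F}$ and $\ell$, such that for all functions $f_1,\dots,f_M$ in $\mathcal{F}_0$ there exists an estimator $\tilde f_n$ (aggregate) of $f$ such that $$\sup_{f\in\mathcal{F}}\left[\mathbb{E}_f\left[\ell(f,\tilde f_n)\right]-\min_{i=1,\dots,M}\ell(f,f_i)\right]\le C\,\psi_n(M),\quad\forall n\in\mathbb{N}^*.$$ (ii) There exist some functions $f_1,\dots,f_M$ in $\mathcal{F}_0$ and a constant $c>0$ independent of $M$ such that for all estimators $\hat f_n$ of $f$, $$\sup_{f\in\mathcal{F}}\left[\mathbb{E}_f\left[\ell(f,\hat f_n)\right]-\min_{i=1,\dots,M}\ell(f,f_i)\right]\ge c\,\psi_n(M),\quad\forall n\in\mathbb{N}^*.$$ When both inequalities are satisfied, the procedure $\tilde f_n$ appearing in (i) is called an optimal aggregation procedure with respect to the loss $\ell$. In the claim, $\mathcal{F}_0=\mathcal{F}_K(A)$, $\mathcal{F}=\mathcal{F}(A)$ and $\ell(f,g)=K(f|g)$. Aggregation procedure with exponential weights: for given densities $f_1,\dots,f_M$, $$\tilde f_n(x)=\sum_{j=1}^M\tilde w_j^{(n)}f_j(x),\quad \forall x\in\mathcal{X},\qquad \tilde w_j^{(n)}=\frac{1}{n+1}\sum_{k=0}^n w_j^{(k)},$$ $$w_j^{(0)}=\frac1M,\qquad w_j^{(k)}=\frac{f_j(X_1)\cdots f_j(X_k)}{\sum_{l=1}^M f_l(X_1)\cdots f_l(X_k)},\quad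 k=1,\dots,n.$$ *)

(* Defs.v *)
From HB Require Import structures.
From mathcomp Require Import all_boot all_order all_algebra.
From mathcomp Require Import all_classical all_reals all_analysis.
From mathcomp Require Import measurable_realfun.

Set Implicit Arguments.
Unset Strict Implicit.
Unset Printing Implicit Defensive.

Import Order.TTheory GRing.Theory Num.Theory.
Local Open Scope classical_set_scope.
Local Open Scope ring_scope.
Local Open Scope ereal_scope.

Section prepend.
Context d (T : measurableType d) (R : realType) (n : nat).
Variables (mu : {sigma_finite_measure set T -> \bar R})
          (nu : {sigma_finite_measure set (n.-tuple T) -> \bar R}).

Definition tcons (p : T * n.-tuple T) : n.+1.-tuple T := [tuple of p.1 :: p.2].

Lemma measurable_tcons : measurable_fun [set: T * n.-tuple T] tcons.
Proof. exact: (measurable_cons measurable_fst measurable_snd). Qed.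

Definition prepend : set (n.+1.-tuple T) -> \bar R :=
  pushforward (mu \x nu) tcons.

Let prepend0 : prepend set0 = 0.
Proof. by rewrite /prepend /pushforward preimage_set0 measure0. Qed.

Let prepend_ge0 A : 0 <= prepend A.
Proof. exact: (measure_ge0 (mu \x nu)). Qed.

Let prepend_semi_sigma_additive : semi_sigma_additive prepend.
Proof.
move=> F mF tF mUF; rewrite /prepend /pushforward preimage_bigcup.
apply: measure_semi_sigma_additive.
- by move=> n'; rewrite -[X in measurable X]setTI; exact: measurable_tcons.
- apply/trivIsetP => /= i j _ _ ij; rewrite -preimage_setI.
  by move/trivIsetP : tF => /(_ _ _ _ _ ij) ->//; rewrite preimage_set0.
- by rewrite -preimage_bigcup -[X in measurable X]setTI; exact: measurable_tcons.
Qed.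

HB.instance Definition _ := isMeasure.Build _ _ _ prepend
  prepend0 prepend_ge0 prepend_semi_sigma_additive.

Let prepend_sigma_finite : sigma_finite [set: n.+1.-tuple T] prepend.
Proof.
have /sigma_finiteP[F [TF ndF Foo]] := sigma_finiteT mu.
have /sigma_finiteP[G [TG ndG Goo]] := sigma_finiteT nu.
pose h (t : n.+1.-tuple T) : T := tnth t ord0.
pose b (t : n.+1.-tuple T) : n.-tuple T := [tuple of behead t].
exists (fun k => (h @^-1` F k) `&` (b @^-1` G k)).
  rewrite predeqE => t; split => // _.
  have [i _ Fi] : (\bigcup_k F k) (h t) by rewrite -TF.
  have [j _ Gj] : (\bigcup_k G k) (b t) by rewrite -TG.
  exists (maxn i j) => //; split.
  - have /subsetPset : (F i <= F (maxn i j))%O by exact/ndF/leq_maxl.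
    by apply.
  - have /subsetPset : (G j <= G (maxn i j))%O by exact/ndG/leq_maxr.
    by apply.
move=> k; have [mF Fk] := Foo k; have [mG Gk] := Goo k; split.
  apply: measurableI.
  - by rewrite -[X in measurable X]setTI; exact: measurable_tnth.
  - by rewrite -[X in measurable X]setTI; exact: measurable_behead.
rewrite /prepend /pushforward (_ : _ @^-1` _ = F k `*` G k).
  by rewrite product_measure1E// lte_mul_pinfty// ge0_fin_numE.
have bK p : b (tcons p) = p.2 by exact/val_inj.
have hK p : h (tcons p) = p.1 by [].
by apply/seteqP; split => p /=; rewrite bK hK.
Qed.

HB.instance Definition _ := Measure_isSigmaFinite.Build _ _ _ prepend
  prepend_sigma_finite.

End prepend.

Fixpoint product_power d (T : measurableType d) (R : realType)
    (mu : {sigma_finite_measure set T -> \bar R}) (n : nat) :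
    {sigma_finite_measure set (n.-tuple T) -> \bar R} :=
  if n is n'.+1 then prepend mu (product_power mu n') else \d_([tuple] : 0.-tuple T).

Section densities.
Context d (T : measurableType d) (R : realType).
Variable mu : {sigma_finite_measure set T -> \bar R}.

Record density := Density {
  pdf :> T -> R ;
  measurable_pdf : measurable_fun [set: T] pdf ;
  pdf_ge0 : forall x, (0 <= pdf x)%R ;
  integral_pdf : \int[mu]_x (pdf x)%:E = 1 }.

Definition law (f : density) : set T -> \bar R :=
  fun A => \int[mu]_(x in A) (f x)%:E.

Section law_probability.
Variable f : density.

Let law0 : law f set0 = 0.
Proof. by rewrite /law integral_set0. Qed.

Let law_ge0 A : 0 <= law f A.
Proof. by apply: integral_ge0 => x _; rewrite lee_fin pdf_ge0. Qed.

Let law_semi_sigma_additive : semi_sigma_additive (law f).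
Proof.
move=> /= F mF tF mUF; rewrite /law; apply: cvg_toP.
  apply: ereal_nondecreasing_is_cvgn => m n mn.
  apply: lee_sum_nneg_natr => // k _ _; exact: law_ge0.
rewrite ge0_integral_bigcup//=.
- apply/measurable_EFinP; apply: (@measurable_funS _ _ _ _ [set: T]) => //.
  exact: measurable_pdf.
- by move=> x _; rewrite lee_fin pdf_ge0.
Qed.

HB.instance Definition _ := isMeasure.Build _ _ _ (law f)
  law0 law_ge0 law_semi_sigma_additive.

HB.instance Definition _ := @Measure_isProbability.Build _ _ R
  (law f) (integral_pdf f).

End law_probability.

Definition sample_law (f : density) (n : nat) :=
  product_power (law f) n.

(* [ln 0 = 0] and division by zero only matter where [f] vanishes, whatever the
   value of the logarithm, or on a [law f]-null set. *)
Definition KL (f g : density) : \bar R :=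
  if `[< law f `<< law g >] then \int[mu]_x (ln (f x / g x) * f x)%:E
  else +oo.

Definition bounded_densities (A : R) : set density :=
  [set f | forall x, (f x <= A)%R].

Record estimator (n : nat) := Estimator {
  estimate :> n.-tuple T -> density ;
  measurable_estimate :
    measurable_fun [set: n.-tuple T * T] (fun p => estimate p.1 p.2) }.

(* When the minimum is [+oo] the difference is [-oo] (in [\bar R],
   [+oo - +oo = -oo]), so that such [f] never contribute to a supremum. *)
Definition excess_risk (l : density -> density -> \bar R) M
    (fs : 'I_M -> density) n (fhat : estimator n) (f : density) : \bar R :=
  \int[sample_law f n]_xs l f (fhat xs) -
  \big[mine/+oo]_(i < M) l f (fs i).

Definition sup_excess_risk (F : set density)
    (l : density -> density -> \bar R) M (fs : 'I_M -> density)
    n (fhat : estimator n) : \bar R :=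
  ereal_sup [set excess_risk l fs fhat f | f in F].

Definition attains_rate (F : set density)
    (l : density -> density -> \bar R) (psi : nat -> nat -> R) (C : R)
    M (fs : 'I_M -> density) (ftilde : forall n, estimator n) :=
  forall n, (0 < n)%N ->
    sup_excess_risk F l fs (ftilde n) <= (C * psi n M)%:E.

(* [regime M n] delimits the pairs for which the lower bound is claimed; the
   functions witnessing it may depend on both [M] and [n], the constant not. *)
Definition optimal_rate_aggregation (F0 F : set density)
    (l : density -> density -> \bar R) (regime : nat -> nat -> Prop)
    (psi : nat -> nat -> R) :=
  [/\ F `<=` F0,
      forall M n, (2 <= M)%N -> (0 < n)%N -> (0 < psi n M)%R,
      exists C : R, forall M (fs : 'I_M -> density), (2 <= M)%N ->
        (forall i, F0 (fs i)) ->
        exists ftilde : forall n, estimator n,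
          attains_rate F l psi C fs ftilde
    & exists2 c : R, (0 < c)%R &
        forall M n, (2 <= M)%N -> (0 < n)%N -> regime M n ->
        exists2 fs : 'I_M -> density, (forall i, F0 (fs i)) &
        forall fhat : estimator n,
          (c * psi n M)%:E <= sup_excess_risk F l fs fhat].

Definition aggregate :=
  forall M, ('I_M -> density) -> forall n, n.-tuple T -> T -> R.

Definition achieves_rate (F0 F : set density)
    (l : density -> density -> \bar R) (psi : nat -> nat -> R)
    (agg : aggregate) :=
  exists C : R, forall M (fs : 'I_M -> density), (2 <= M)%N ->
    (forall i, F0 (fs i)) ->
    exists2 ftilde : forall n, estimator n,
      (forall n xs x, ftilde n xs x = agg M fs n xs x) &
      attains_rate F l psi C fs ftilde.

Definition optimal_aggregation_procedure (F0 F : set density)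
    (l : density -> density -> \bar R) (regime : nat -> nat -> Prop)
    (psi : nat -> nat -> R) (agg : aggregate) :=
  optimal_rate_aggregation F0 F l regime psi /\ achieves_rate F0 F l psi agg.

Section exponential_weights.
Local Open Scope ring_scope.
Variables (M : nat) (fs : 'I_M -> density) (n : nat) (xs : n.-tuple T).

Definition likelihood (k : nat) (j : 'I_M) : R :=
  \prod_(i < n | (i < k)%N) fs j (tnth xs i).

(* The case [k = 0] gives [1 / M], the products being empty. Where all the
   likelihoods vanish the quotient is undefined; the weights are then uniform. *)
Definition exp_weight (k : nat) (j : 'I_M) : R :=
  let s := \sum_(l < M) likelihood k l in
  if s == 0 then M%:R^-1 else likelihood k j / s.

Definition averaged_weight (j : 'I_M) : R :=
  n.+1%:R^-1 * \sum_(k < n.+1) exp_weight k j.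

Definition exp_weights_aggregate (x : T) : R :=
  \sum_(j < M) averaged_weight j * fs j x.

End exponential_weights.

End densities.

Arguments KL {d T R} mu f g.
Arguments bounded_densities {d T R} mu A.
Arguments exp_weights_aggregate {d T R} mu M fs n xs x.

Definition lebesgue_Rd (R : realType) (d : nat) :
    {sigma_finite_measure set (d.-tuple (measurableTypeR R)) -> \bar R} :=
  product_power (@lebesgue_measure R) d.

(* Main.v *)
(**
  Upper bound. Averaging over the [n + 1] mixtures and using convexity of the
  divergence in its second argument, it suffices to bound
  [\sum_(k <= n) E K(f | \sum_j w_j^(k) f_j)]. Condition on the first
  observation [x]: the later weights are those of the same procedure started from
  the prior [pi_j f_j(x)]. By the chain rule for the logarithm, the divergence
  of the first mixture plus the expected [- ln] posterior mass of [j] is at most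
  [- ln] of the prior mass of [j] plus [K(f | f_j)]. By induction on [n] the sum
  is at most [ln M + (n + 1) K(f | f_j)].

  Lower bound. Split a set of measure one into [2 ^ M] cells of equal measure,
  indexed by the subsets of [M], and let [f_j = 1 +- delta] according to whether
  [j] belongs to the index, with [delta^2 = ln M / (64 n)]; the regime ensures
  [f_j <= A]. Distinct [f_i], [f_j] are at squared Hellinger distance at least
  [delta^2 / 3], so an estimator is close to at most one of them, and the second
  moment [(1 + delta^2)^n <= M^(1/64)] of the likelihoods bounds the average
  probability that it is close to the right one.
*)

Require Import Defs.
From mathcomp Require Import all_boot all_order all_algebra.
From mathcomp Require Import all_classical all_reals all_analysis.
From mathcomp Require Import measurable_realfun ring lra.

Set Implicit Arguments.
Unset Strict Implicit.
Unset Printing Implicit Defensive.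

Import Order.TTheory GRing.Theory Num.Theory.
Local Open Scope classical_set_scope.
Local Open Scope ring_scope.

(** * Integration *)

Section integration.
Local Open Scope ereal_scope.
Context d (T : measurableType d) (R : realType).
Import HBNNSimple.

(** The integral of a nonnegative function is a supremum over the simple functions below it, so
    monotonicity is an inclusion of index sets. *)
Lemma le_integral_ge0 (mu : {measure set T -> \bar R}) (f g : T -> \bar R) :
  (forall x, 0 <= f x) -> (forall x, f x <= g x) ->
  \int[mu]_x f x <= \int[mu]_x g x.
Proof.
move=> f0 fg.
have g0 x : 0 <= g x by exact: le_trans (f0 x) (fg x).
rewrite !ge0_integralTE//; apply: ereal_sup_le => _ [h hf <-].
by exists h => // x; exact: le_trans (hf x) (fg x).
Qed.

Lemma integral_lincomb (mu : {measure set T -> \bar R}) (I : finType)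
    (c a : I -> R) (g : I -> T -> R) :
  (forall i, 0 <= c i)%R -> (forall i x, 0 <= g i x)%R ->
  (forall i, measurable_fun [set: T] (g i)) ->
  (forall i, \int[mu]_x (g i x)%:E = (a i)%:E) ->
  \int[mu]_x (\sum_i c i * g i x)%:E = (\sum_i c i * a i)%:E.
Proof.
move=> c0 g0 mg ga; under eq_integral do rewrite -sumEFin.
rewrite ge0_integral_sum//; last 2 first.
- by move=> i; apply/measurable_EFinP; exact: measurable_funM.
- by move=> i x _; rewrite lee_fin mulr_ge0.
rewrite -sumEFin; apply: eq_bigr => i _; under eq_integral do rewrite EFinM.
rewrite ge0_integralZl_EFin ?ga//; last exact/measurable_EFinP.
by move=> x _; rewrite lee_fin.
Qed.

Variable mu : {sigma_finite_measure set T -> \bar R}.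
Implicit Type f : density mu.

Lemma measurable_pdf_EFin f : measurable_fun [set: T] (EFin \o f).
Proof. by apply/measurable_EFinP; exact: measurable_pdf. Qed.

(** For the indicator of a measurable set this is the definition of [law]; simple functions follow
    by linearity and the general case by monotone convergence on both sides. *)
Lemma integral_law f (h : T -> \bar R) :
  measurable_fun [set: T] h -> (forall x, 0 <= h x) ->
  \int[law f]_x h x = \int[mu]_x ((f x)%:E * h x).
Proof.
move=> mh h0.
pose g := nnsfun_approx measurableT mh.
have gh x : EFin (g n x) @[n --> \oo] --> h x by exact: cvg_nnsfun_approx.
have ndg m n x : (m <= n)%N -> (g m x <= g n x)%R.
  by move=> mn; exact/lefP/nd_nnsfun_approx.
transitivity (limn (fun n => \int[law f]_x (g n x)%:E)).
  rewrite -monotone_convergence//.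
  - by apply: eq_integral => x _; apply/esym/cvg_lim.
  - by move=> n; exact/measurable_EFinP.
  - by move=> n x _; rewrite lee_fin.
  - by move=> x _ m n mn; rewrite lee_fin ndg.
transitivity (limn (fun n => \int[mu]_x ((f x)%:E * (g n x)%:E))); last first.
  rewrite -monotone_convergence//.
  - apply: eq_integral => x _; apply/cvg_lim => //; exact: cvgeZl.
  - move=> n; apply: emeasurable_funM; first exact: measurable_pdf_EFin.
    exact/measurable_EFinP.
  - by move=> n x _; rewrite mule_ge0// lee_fin// pdf_ge0.
  - by move=> x _ m n mn; rewrite lee_wpmul2l// lee_fin ?pdf_ge0 ?ndg.
congr (limn _); apply/funext => n.
rewrite integralT_nnsfun sintegralE.
under [RHS]eq_integral => x _.
  rewrite fimfunE -fsumEFin// ge0_mule_fsumr; last first.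
    by move=> y; rewrite nnfun_muleindic_ge0.
  over.
rewrite ge0_integral_fsum//; last 2 first.
- move=> y; apply: emeasurable_funM; first exact: measurable_pdf_EFin.
  apply/measurable_EFinP; exact: measurable_funM.
- move=> y x _; rewrite mule_ge0 ?lee_fin ?pdf_ge0// -lee_fin EFinM.
  exact: nnfun_muleindic_ge0.
apply: eq_fsbigr => r; rewrite inE => -[x0 _ <-].
rewrite /= /law [X in _ * X = _]integral_mkcond -ge0_integralZl_EFin//; last 2 first.
- by move=> x _; rewrite erestrict_ge0// => y _; rewrite lee_fin pdf_ge0.
- apply/(measurable_restrictT _ _).1 => //.
  exact/measurable_funTS/measurable_pdf_EFin.
apply: eq_integral => x _; rewrite patchE indicE.
by case: ifPn => _; rewrite ?mule0 ?mulr0 ?mule0// mulr1 muleC.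
Qed.
End integration.

(** * Iterated integrals against product powers and laws of samples *)

Section sampling.
Local Open Scope ereal_scope.
Context d (T : measurableType d) (R : realType).

Lemma tnth_tcons_lift n (x : T) (ys : n.-tuple T) (i : 'I_n) :
  tnth (tcons (x, ys)) (lift ord0 i) = tnth ys i.
Proof. by rewrite (tnth_nth x) [RHS](tnth_nth x). Qed.

Lemma measurable_fun_prefix n (h : n.+1.-tuple T -> \bar R) :
  measurable_fun [set: n.+1.-tuple T] h ->
  measurable_fun [set: T * n.-tuple T] (h \o @tcons _ T n).
Proof. by move=> mh; apply: measurableT_comp => //; exact: measurable_tcons. Qed.

(** Tonelli's theorem, the product power being the image under [tcons] of a product measure. *)
Lemma integral_product_powerS (mu : {sigma_finite_measure set T -> \bar R}) n
    (h : n.+1.-tuple T -> \bar R) :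
  measurable_fun [set: n.+1.-tuple T] h -> (forall xs, 0 <= h xs) ->
  \int[product_power mu n.+1]_xs h xs =
  \int[mu]_x \int[product_power mu n]_ys h (tcons (x, ys)).
Proof.
move=> mh h0.
rewrite (ge0_integral_pushforward (@measurable_tcons _ T n) (mu \x product_power mu n))//.
rewrite preimage_setT fubini_tonelli1//; last by move=> x /=.
exact: measurable_fun_prefix.
Qed.

Lemma integral_product_power0 (mu : {sigma_finite_measure set T -> \bar R})
    (h : 0.-tuple T -> \bar R) :
  measurable_fun [set: 0.-tuple T] h -> (forall xs, 0 <= h xs) ->
  \int[product_power mu 0]_xs h xs = h [tuple].
Proof. by move=> mh h0; rewrite /= integral_dirac// diracT mul1e. Qed.

Variable mu : {sigma_finite_measure set T -> \bar R}.

Lemma integral_sampleS (f : density mu) n (h : n.+1.-tuple T -> \bar R) :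
  measurable_fun [set: n.+1.-tuple T] h -> (forall xs, 0 <= h xs) ->
  \int[sample_law f n.+1]_xs h xs =
  \int[mu]_x ((f x)%:E * \int[sample_law f n]_ys h (tcons (x, ys))).
Proof.
move=> mh h0; rewrite [LHS]integral_product_powerS// integral_law//.
- apply: (measurable_fun_fubini_tonelli_F (h \o @tcons _ T n)) => [|x /=] //.
  exact: measurable_fun_prefix.
- by move=> x; exact: integral_ge0.
Qed.

Lemma integral_sample_cst (f : density mu) n (c : \bar R) : 0 <= c ->
  \int[sample_law f n]_xs c = c.
Proof.
move=> c0; elim: n => [|n IH]; first by rewrite integral_product_power0.
rewrite integral_sampleS// IH; under eq_integral do rewrite muleC.
rewrite ge0_integralZl ?integral_pdf ?mule1//.
- exact: measurable_pdf_EFin.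
- by move=> x _; rewrite lee_fin pdf_ge0.
Qed.

Lemma integral_prod_tnth n (g : T -> R) (v : R) : (forall x, 0 <= g x)%R ->
  measurable_fun [set: T] g -> \int[mu]_x (g x)%:E = v%:E ->
  \int[product_power mu n]_xs (\prod_(i < n) g (tnth xs i))%:E = (v ^+ n)%:E.
Proof.
move=> g0 mg gv.
have mprod k : measurable_fun [set: k.-tuple T]
    (fun xs : k.-tuple T => \prod_(i < k) g (tnth xs i))%R.
  apply: measurable_prod => i _.
  by apply: measurableT_comp => //; exact: measurable_tnth.
elim: n => [|n IH].
  rewrite integral_product_power0.
  - by rewrite big_ord0 expr0.
  - apply/measurable_EFinP; exact: mprod.
  - by move=> xs; rewrite lee_fin prodr_ge0.
rewrite integral_product_powerS//; last 2 first.
- apply/measurable_EFinP; exact: mprod.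
- by move=> xs; rewrite lee_fin prodr_ge0.
under eq_integral => x _.
  under eq_integral => ys _.
    rewrite big_ord_recl EFinM /= (_ : tnth _ ord0 = x)//.
    under eq_bigr do rewrite tnth_tcons_lift.
    over.
  rewrite ge0_integralZl_EFin//.
  - rewrite IH muleC; over.
  - by move=> ys _; rewrite lee_fin prodr_ge0.
  - apply/measurable_EFinP; exact: mprod.
have v0 : (0 <= v)%R.
  by rewrite -lee_fin -gv; apply: integral_ge0 => x _; rewrite lee_fin.
rewrite ge0_integralZl_EFin ?gv ?exprSr ?exprn_ge0//.
- by move=> x _; rewrite lee_fin.
- exact/measurable_EFinP.
Qed.

Lemma measurable_prod_tnth (f : density mu) n :
  measurable_fun [set: n.-tuple T]
    (fun xs : n.-tuple T => (\prod_(i < n) f (tnth xs i))%:E).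
Proof.
apply/measurable_EFinP/measurable_prod => i _.
by apply: (measurableT_comp (measurable_pdf f)); exact: measurable_tnth.
Qed.

(** The likelihood is the density of the sample law. This puts the laws of samples from different
    densities over one common measure, as the lower bound requires. *)
Lemma integral_sample_law (f : density mu) n (h : n.-tuple T -> \bar R) :
  measurable_fun [set: n.-tuple T] h -> (forall xs, 0 <= h xs) ->
  \int[sample_law f n]_xs h xs =
  \int[product_power mu n]_xs ((\prod_(i < n) f (tnth xs i))%:E * h xs).
Proof.
elim: n h => [|n IH] h mh h0.
  rewrite !integral_product_power0//.
  - by rewrite big_ord0 mul1e.
  - by apply: emeasurable_funM => //; exact: measurable_prod_tnth.
  - by move=> xs; rewrite big_ord0 mul1e.
have mtail x : measurable_fun [set: n.-tuple T] (fun ys => h (tcons (x, ys))).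
  exact: (measurableT_comp (measurable_fun_prefix mh) (pair1_measurable x)).
rewrite integral_sampleS// integral_product_powerS//; last 2 first.
- by apply: emeasurable_funM => //; exact: measurable_prod_tnth.
- by move=> xs; rewrite mule_ge0// lee_fin prodr_ge0// => i _; exact: pdf_ge0.
apply: eq_integral => x _; rewrite IH// -ge0_integralZl_EFin//; last 3 first.
- move=> ys _; rewrite mule_ge0// lee_fin prodr_ge0// => i _; exact: pdf_ge0.
- by apply: emeasurable_funM => //; exact: measurable_prod_tnth.
- exact: pdf_ge0.
apply: eq_integral => ys _; rewrite muleA -EFinM big_ord_recl.
by under [in RHS]eq_bigr do rewrite tnth_tcons_lift.
Qed.
End sampling.

(** * The relative entropy integrand *)

Section kl_term.
Context {R : realType}.
Implicit Types a b : R.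

(* Subtracting [a] and adding [b] does not change the integral over densities but
   makes the integrand nonnegative, so that Tonelli applies and no integrability
   has to be discussed. *)
Definition kl_term a b : \bar R :=
  if (0 < a) && (b == 0) then +oo%E else (a * ln (a / b) - a + b)%:E.

Lemma kl_term0l b : kl_term 0 b = b%:E.
Proof. by rewrite /kl_term ltxx mul0r subrr add0r. Qed.

Lemma kl_term_pos0 a : 0 < a -> kl_term a 0 = +oo%E.
Proof. by rewrite /kl_term => ->; rewrite eqxx. Qed.

Lemma kl_term_pos a b : 0 < b -> kl_term a b = (a * ln (a / b) - a + b)%:E.
Proof. by move=> b0; rewrite /kl_term (gt_eqF b0) andbF. Qed.

Lemma kl_term_self a : 0 <= a -> kl_term a a = 0%E.
Proof.
rewrite le_eqVlt => /predU1P[<-|a0]; first by rewrite kl_term0l.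
by rewrite kl_term_pos// divff ?gt_eqF// ln1 mulr0 sub0r addNr.
Qed.

Lemma ln_le_subr1 (x : R) : 0 < x -> ln x <= x - 1.
Proof.
by move=> x0; rewrite -[in leLHS](subrK 1 x) addrC le_ln1Dx// ltrBrDl subrr.
Qed.

(* [ln (b / a) = 2 ln (sqrt b / sqrt a) <= 2 (sqrt b / sqrt a - 1)] *)
Lemma hellinger_le_kl_term a b : 0 <= a -> 0 <= b ->
  (((Num.sqrt a - Num.sqrt b) ^+ 2)%:E <= kl_term a b)%E.
Proof.
rewrite le_eqVlt => /predU1P[<- b0|a0].
  by rewrite kl_term0l sqrtr0 sub0r sqrrN sqr_sqrtr.
rewrite le_eqVlt => /predU1P[<-|b0]; first by rewrite kl_term_pos0// leey.
rewrite kl_term_pos// lee_fin.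
have [sa sb] : 0 < Num.sqrt a /\ 0 < Num.sqrt b by rewrite !sqrtr_gt0.
have ha : Num.sqrt a ^+ 2 = a by rewrite sqr_sqrtr// ltW.
have hb : Num.sqrt b ^+ 2 = b by rewrite sqr_sqrtr// ltW.
move: sa sb ha hb; set u := Num.sqrt a; set v := Num.sqrt b => u0 v0 <- <-.
have -> : u ^+ 2 / v ^+ 2 = ((v / u)^-1) ^+ 2.
  by rewrite invf_div expr_div_n.
rewrite lnXn ?invr_gt0 ?divr_gt0// lnV ?posrE ?divr_gt0//.
have : u ^+ 2 * ln (v / u) <= u ^+ 2 * (v / u - 1).
  by rewrite ler_pM2l ?exprn_gt0// ln_le_subr1// divr_gt0.
have -> : u ^+ 2 * (v / u - 1) = u * v - u ^+ 2 by field; rewrite gt_eqF.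
rewrite mulr2n; lra.
Qed.

Lemma kl_term_ge0 a b : 0 <= a -> 0 <= b -> (0 <= kl_term a b)%E.
Proof.
move=> a0 b0; apply: le_trans (hellinger_le_kl_term a0 b0).
by rewrite lee_fin sqr_ge0.
Qed.

(** The left-hand side is the tangent at [b0] of the convex function [kl_term a]; the inequality
    reduces to [ln y <= y - 1] at [y = b / b0]. *)
Lemma kl_term_ge_tangent a b0 b : 0 <= a -> 0 < b0 -> 0 <= b ->
  ((a * ln (a / b0) - a + b0 + (1 - a / b0) * (b - b0))%:E <= kl_term a b)%E.
Proof.
rewrite le_eqVlt => /predU1P[<- _ _|a0 b00].
  by rewrite kl_term0l lee_fin !mul0r subr0; lra.
rewrite le_eqVlt => /predU1P[<-|bgt0]; first by rewrite kl_term_pos0// leey.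
rewrite kl_term_pos// lee_fin !ln_div ?posrE//.
have : a * ln (b / b0) <= a * (b / b0 - 1).
  by rewrite ler_pM2l// ln_le_subr1// divr_gt0.
rewrite ln_div ?posrE//.
have -> : (1 - a / b0) * (b - b0) = b - b0 - a * (b / b0 - 1).
  by field; rewrite gt_eqF.
lra.
Qed.

(* Jensen's inequality for the convex function [kl_term a], through its tangent
   at the mean. *)
Lemma kl_term_mean a n (b : 'I_n.+1 -> R) : 0 <= a -> (forall k, 0 <= b k) ->
  (n.+1%:R%:E * kl_term a (n.+1%:R^-1 * \sum_k b k) <= \sum_k kl_term a (b k))%E.
Proof.
move=> a0 b0; set m := n.+1%:R^-1 * _.
have n0 : 0 < n.+1%:R :> R by rewrite ltr0n.
have mE : n.+1%:R * m = \sum_k b k by rewrite /m mulrA divff ?mul1r ?gt_eqF.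
have : 0 <= m by apply: mulr_ge0; [rewrite invr_ge0 ltW|exact: sumr_ge0].
(* No tangent is available at a zero mean, but then every [b k] is zero and the two sides agree. *)
rewrite le_eqVlt => /predU1P[m0|m0].
  have bk0 k : b k = 0.
    move: mE; rewrite -m0 mulr0 => /esym/eqP.
    by rewrite psumr_eq0// => /allP/(_ k (mem_index_enum _))/eqP.
  under eq_bigr do rewrite bk0.
  by rewrite -m0 sumr_const card_ord muleC mule_natr.
apply: le_trans (lee_sum _ (fun k _ => kl_term_ge_tangent a0 m0 (b0 k))).
rewrite kl_term_pos// sumEFin -EFinM lee_fin big_split/= -mulr_sumr.
by rewrite sumrB !sumr_const card_ord -mE !mulr_natl subrr mulr0 addr0.
Qed.

Lemma measurable_inv : measurable_fun [set: R] (@GRing.inv R).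
Proof.
rewrite (_ : GRing.inv = fun x : R => x * (x ^+ 2) `^ (-1)).
  by apply: measurable_funM => //; 
  apply: (@measurableT_comp _ _ _ _ _ _ (@powR R ^~ (-1))) => //.
apply/funext => x; rewrite powR_inv1 ?sqr_ge0//.
have [->|x0] := eqVneq x 0; first by rewrite invr0 mul0r.
by rewrite expr2 invfM mulrA divff// mul1r.
Qed.

Lemma measurable_kl_term d (T : measurableType d) (f g : T -> R) :
  measurable_fun [set: T] f -> measurable_fun [set: T] g ->
  measurable_fun [set: T] (fun x => kl_term (f x) (g x)).
Proof.
move=> mf mg; apply: measurable_fun_ifT => //.
- apply: measurable_and; first exact: measurable_fun_ltr.
  exact: measurable_fun_eqr.
- apply/measurable_EFinP; apply: measurable_funD => //.
  apply: measurable_funB => //; apply: measurable_funM => //.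
  apply: measurableT_comp => //; apply: measurable_funM => //.
  by apply: measurableT_comp => //; exact: measurable_inv.
Qed.
End kl_term.

(** * The divergence as the integral of [kl_term] *)

Section kl.
Local Open Scope ereal_scope.
Context d (T : measurableType d) (R : realType).
Variable mu : {sigma_finite_measure set T -> \bar R}.
Implicit Types f g : density mu.

(** Turns null sets of a law into almost-everywhere vanishing of its density, the form in which
    domination is used below. *)
Lemma law_eq0 g A : measurable A ->
  law g A = 0 <-> ae_eq mu A (EFin \o g) (cst 0).
Proof.
move=> mA; rewrite -ae_eq_integral_abs//; last first.
  exact/measurable_funTS/measurable_pdf_EFin.
rewrite /law; suff -> : \int[mu]_(x in A) `|(EFin \o g) x| =
  \int[mu]_(x in A) (g x)%:E by [].
by apply: eq_integral => x _ /=; rewrite ger0_norm// pdf_ge0.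
Qed.

Let measurable_kl_pdf f g :
  measurable_fun [set: T] (fun x => kl_term (f x) (g x)).
Proof. by apply: measurable_kl_term; exact: measurable_pdf. Qed.

(** Some [A] is null for [law g] but not for [law f]. There [g] vanishes almost everywhere, so the
    integral over [A] is [+oo] times the positive mass [law f A]. *)
Lemma KLE_not_dominated f g : ~ law f `<< law g ->
  \int[mu]_x kl_term (f x) (g x) = +oo.
Proof.
move/null_content_dominatesP => /existsNP[A /not_implyP[mA /not_implyP[gA fA]]].
apply/eqP; rewrite eq_le leey/=.
have k0 x : 0 <= kl_term (f x) (g x) by rewrite kl_term_ge0// pdf_ge0.
apply: (@le_trans _ _ (\int[mu]_(x in A) kl_term (f x) (g x))); last first.
  exact: ge0_subset_integral.
have fge0 x : A x -> 0 <= (f x)%:E by rewrite lee_fin pdf_ge0.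
have mfA : measurable_fun A (EFin \o f).
  exact/measurable_funTS/measurable_pdf_EFin.
suff -> : \int[mu]_(x in A) kl_term (f x) (g x) =
    \int[mu]_(x in A) (+oo * (f x)%:E).
  rewrite ge0_integralZl// gt0_mulye// lt0e; apply/andP; split; first exact/eqP.
  exact: integral_ge0.
apply: ge0_ae_eq_integral => //.
- exact: measurable_funTS.
- exact: emeasurable_funM.
- by move=> x Ax; rewrite mule_ge0 ?fge0.
move/law_eq0 : gA => /(_ mA); apply: filterS => x /= gx Ax.
move: (gx Ax) => [->]; have := pdf_ge0 f x.
rewrite le_eqVlt => /predU1P[<-|fx0]; first by rewrite kl_term0l mule0.
by rewrite kl_term_pos0// gt0_mulye.
Qed.

(* Integrating [f ln (f / g) = kl_term f g + f - g]; the negative part of the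
   left-hand side is at most [g]. *)
Lemma KLE_dominated f g : law f `<< law g ->
  \int[mu]_x (ln (f x / g x) * f x)%:E = \int[mu]_x kl_term (f x) (g x).
Proof.
move=> fg; pose u x := (ln (f x / g x) * f x)%:E.
have mu_ : measurable_fun [set: T] u.
  apply/measurable_EFinP; apply: measurable_funM; last exact: measurable_pdf.
  apply: (measurableT_comp (@measurable_ln R)).
  apply: measurable_funM; first exact: measurable_pdf.
  by apply: (measurableT_comp (@measurable_inv R)); exact: measurable_pdf.
have f0 x : 0 <= (f x)%:E by rewrite lee_fin pdf_ge0.
have g0 x : 0 <= (g x)%:E by rewrite lee_fin pdf_ge0.
have k0 x : 0 <= kl_term (f x) (g x) by rewrite kl_term_ge0// pdf_ge0.
have mf := measurable_pdf_EFin f; have mg := measurable_pdf_EFin g.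
have mup := measurable_funepos mu_; have mun := measurable_funeneg mu_.
have ung x : u^\- x <= (g x)%:E.
  rewrite /u funenegE ge_max g0 andbT -EFinN lee_fin.
  have := pdf_ge0 f x; rewrite le_eqVlt => /predU1P[<-|fx0].
    by rewrite mulr0 oppr0 pdf_ge0.
  have := pdf_ge0 g x; rewrite le_eqVlt => /predU1P[<-|gx0].
    (* Where [g x = 0 < f x] the default values give [f x / g x = 0] and [ln 0 = 0], so [u]
       vanishes. *)
    by rewrite invr0 mulr0 ln0// mul0r oppr0.
  have := @kl_term_ge0 _ (f x) (g x) (ltW fx0) (ltW gx0).
  by rewrite kl_term_pos// lee_fin; nra.
have intun : \int[mu]_x u^\- x \is a fin_num.
  rewrite ge0_fin_numE ?integral_ge0//.
  by rewrite (le_lt_trans (le_integral_ge0 mu _ ung))// integral_pdf ltry.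
(* Integrated form of [u^\+ + g = kl_term f g + f + u^\-], in which every term is nonnegative; the
   constants are the integrals of [g] on the left and [f] on the right. *)
have key : \int[mu]_x u^\+ x + 1 = \int[mu]_x kl_term (f x) (g x) + 1 +
    \int[mu]_x u^\- x.
  rewrite -{1}(integral_pdf g) -(integral_pdf f).
  rewrite -!ge0_integralD//; last 2 first.
    by move=> x _; rewrite adde_ge0.
    exact: emeasurable_funD.
  apply: ge0_ae_eq_integral => //.
  - exact: emeasurable_funD.
  - by apply: emeasurable_funD => //; exact: emeasurable_funD.
  - by move=> x _; rewrite adde_ge0.
  - by move=> x _; rewrite !adde_ge0.
  (* The identity can fail pointwise only where [g] is zero and [f] is not; by domination [f]
     vanishes almost everywhere on [N]. *)
  pose N : set T := g @^-1` [set (0 : R)%R].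
  have mN : measurable N.
    by rewrite -[N]setTI; apply: (measurable_pdf g) => //; exact: measurable_set1.
  have gN : law g N = 0.
    by rewrite /law integral0_eq// => x; rewrite /N/= => ->.
  have /null_content_dominatesP/(_ N mN gN)/(law_eq0 _ mN) := fg.
  apply: filterS => x /= fN _.
  have [gx0|gx0] := eqVneq (g x) (0 : R)%R.
    have [fx0] := fN gx0.
    by rewrite /u funeposE funenegE fx0 gx0 mulr0 kl_term0l oppe0 !maxxx !adde0.
  have {}gx0 : (0 < g x)%R by rewrite lt0r gx0 pdf_ge0.
  rewrite kl_term_pos// funeposE funenegE /u.
  set v := (ln _ * _)%R; rewrite -EFinN -!EFin_max -!EFinD; congr EFin.
  rewrite (mulrC (f x)) -/v.
  by case: (lerP v 0); case: (lerP (-v) 0); lra.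
rewrite integralE; move: key; rewrite -/u.
by rewrite -[X in X - _](@addeK _ 1)// => ->; rewrite addeAC addeK// addeK.
Qed.

Lemma KLE f g : KL mu f g = \int[mu]_x kl_term (f x) (g x).
Proof.
rewrite /KL; case: asboolP => [/KLE_dominated//|/KLE_not_dominated//].
Qed.

Lemma KL_ge0 f g : 0 <= KL mu f g.
Proof.
by rewrite KLE; apply: integral_ge0 => x _; rewrite kl_term_ge0// pdf_ge0.
Qed.

Lemma KL_self f : KL mu f f = 0.
Proof.
by rewrite KLE integral0_eq// => x _; rewrite kl_term_self// pdf_ge0.
Qed.

End kl.

(** * Exponential weights *)

Section gibbs.
Context d (T : measurableType d) (R : realType).
Variable mu : {sigma_finite_measure set T -> \bar R}.
Variables (M : nat) (fs : 'I_M -> density mu).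
Hypothesis M_gt0 : (0 < M)%N.
Implicit Type pi : 'I_M -> R.

(* The exponential weights are the case [pi = 1]. Unnormalised priors make the
   recursion [gibbs_weightS] hold without exception, including where all the
   likelihoods vanish. *)
Definition gibbs_weight pi n (xs : n.-tuple T) k j : R :=
  let s := \sum_l pi l * likelihood fs xs k l in
  if s == 0 then M%:R^-1 else pi j * likelihood fs xs k j / s.

Definition gibbs_mixture pi n (xs : n.-tuple T) k x : R :=
  \sum_j gibbs_weight pi xs k j * fs j x.

Lemma likelihood0 n (xs : n.-tuple T) j : likelihood fs xs 0 j = 1.
Proof. by rewrite /likelihood big_pred0. Qed.

Lemma likelihoodS n x (ys : n.-tuple T) k j :
  likelihood fs (tcons (x, ys)) k.+1 j = fs j x * likelihood fs ys k j.
Proof.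
rewrite /likelihood big_mkcond big_ord_recl /=; congr (_ * _).
rewrite [RHS]big_mkcond; apply: eq_bigr => i _.
by rewrite tnth_tcons_lift.
Qed.

Lemma likelihood_ge0 n (xs : n.-tuple T) k j : 0 <= likelihood fs xs k j.
Proof. by apply: prodr_ge0 => i _; exact: pdf_ge0. Qed.

Lemma exp_weightE n (xs : n.-tuple T) k j :
  exp_weight fs xs k j = gibbs_weight (fun=> 1) xs k j.
Proof.
rewrite /exp_weight /gibbs_weight.
by under [in RHS]eq_bigr do rewrite mul1r; rewrite mul1r.
Qed.

(** Bayesian updating: the first observation is absorbed into the prior. This drives the induction
    on the sample size. *)
Lemma gibbs_weightS pi n x (ys : n.-tuple T) k j :
  gibbs_weight pi (tcons (x, ys)) k.+1 j =
  gibbs_weight (fun l => pi l * fs l x) ys k j.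
Proof.
rewrite /gibbs_weight likelihoodS mulrA.
by under eq_bigr do rewrite likelihoodS mulrA.
Qed.

Lemma gibbs_mixture0 pi n (xs : n.-tuple T) x : \sum_l pi l != 0 ->
  gibbs_mixture pi xs 0 x = (\sum_l pi l * fs l x) / \sum_l pi l.
Proof.
move=> s0; rewrite /gibbs_mixture mulr_suml; apply: eq_bigr => j _.
rewrite /gibbs_weight likelihood0 mulr1.
under eq_bigr do rewrite likelihood0 mulr1.
by rewrite (negbTE s0) mulrAC.
Qed.

Lemma gibbs_weight_ge0 pi n (xs : n.-tuple T) k j : (forall l, 0 <= pi l) ->
  0 <= gibbs_weight pi xs k j.
Proof.
move=> pi0; rewrite /gibbs_weight; case: ifPn => _; first by rewrite invr_ge0.
have h l : 0 <= pi l * likelihood fs xs k l by rewrite mulr_ge0 ?likelihood_ge0.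
by apply: divr_ge0 => //; exact: sumr_ge0.
Qed.

Lemma sum_gibbs_weight pi n (xs : n.-tuple T) k :
  \sum_j gibbs_weight pi xs k j = 1.
Proof.
have [s0|s0] := eqVneq (\sum_l pi l * likelihood fs xs k l) 0.
  under eq_bigr do rewrite /gibbs_weight s0 eqxx.
  by rewrite sumr_const card_ord -[LHS]mulr_natl divff// pnatr_eq0 -lt0n.
under eq_bigr do rewrite /gibbs_weight (negbTE s0).
by rewrite -mulr_suml divff.
Qed.

Lemma gibbs_mixture_ge0 pi n (xs : n.-tuple T) k x : (forall l, 0 <= pi l) ->
  0 <= gibbs_mixture pi xs k x.
Proof.
move=> pi0; apply: sumr_ge0 => j _.
by rewrite mulr_ge0 ?gibbs_weight_ge0 ?pdf_ge0.
Qed.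

Lemma measurable_likelihood n k j :
  measurable_fun [set: n.-tuple T] (fun xs : n.-tuple T => likelihood fs xs k j).
Proof.
under eq_fun do rewrite /likelihood -big_filter.
apply: measurable_prod => i _.
by apply: (measurableT_comp (measurable_pdf _)); exact: measurable_tnth.
Qed.

Lemma measurable_gibbs_weight pi n k j : measurable_fun [set: n.-tuple T]
  (fun xs : n.-tuple T => gibbs_weight pi xs k j).
Proof.
have ms : measurable_fun [set: n.-tuple T]
    (fun xs : n.-tuple T => \sum_l pi l * likelihood fs xs k l).
  apply: measurable_sum => l; apply: measurable_funM => //.
  exact: measurable_likelihood.
apply: measurable_fun_ifT => //; first exact: measurable_fun_eqr.
apply: measurable_funM; last first.
  by apply: (measurableT_comp (@measurable_inv R)).
by apply: measurable_funM => //; exact: measurable_likelihood.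
Qed.

Lemma measurable_gibbs_mixture pi n k : measurable_fun [set: n.-tuple T * T]
  (fun p => gibbs_mixture pi p.1 k p.2).
Proof.
apply: measurable_sum => j; apply: measurable_funM.
  exact: (measurableT_comp (measurable_gibbs_weight pi k j) measurable_fst).
exact: (measurableT_comp (measurable_pdf (fs j)) measurable_snd).
Qed.

Local Open Scope ereal_scope.

Lemma exp_weights_aggregateE n (xs : n.-tuple T) x :
  exp_weights_aggregate mu M fs n xs x =
  (n.+1%:R^-1 * \sum_(k < n.+1) gibbs_mixture (fun=> 1) xs k x)%R.
Proof.
rewrite /exp_weights_aggregate /averaged_weight /gibbs_mixture.
rewrite exchange_big mulr_sumr; apply: eq_bigr => j _ /=.
rewrite -mulrA mulr_suml; congr (_ * _)%R.
by apply: eq_bigr => k _; rewrite exp_weightE.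
Qed.

Lemma measurable_exp_weights_aggregate n : measurable_fun [set: n.-tuple T * T]
  (fun p => exp_weights_aggregate mu M fs n p.1 p.2).
Proof.
under eq_fun do rewrite exp_weights_aggregateE.
apply: measurable_funM => //; apply: measurable_sum => k.
exact: measurable_gibbs_mixture.
Qed.

Lemma averaged_weight_ge0 n (xs : n.-tuple T) j :
  (0 <= averaged_weight fs xs j)%R.
Proof.
rewrite mulr_ge0 ?invr_ge0// sumr_ge0// => k _.
by rewrite exp_weightE gibbs_weight_ge0.
Qed.

Lemma sum_averaged_weight n (xs : n.-tuple T) :
  (\sum_j averaged_weight fs xs j = 1)%R.
Proof.
rewrite -mulr_sumr exchange_big /=.
under eq_bigr => k _.
  under eq_bigr do rewrite exp_weightE.
  rewrite sum_gibbs_weight; over.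
by rewrite sumr_const card_ord mulVf// pnatr_eq0.
Qed.

Lemma exp_weights_aggregate_ge0 n (xs : n.-tuple T) x :
  (0 <= exp_weights_aggregate mu M fs n xs x)%R.
Proof.
by apply: sumr_ge0 => j _; rewrite mulr_ge0 ?averaged_weight_ge0 ?pdf_ge0.
Qed.

Lemma integral_convex_combination (w : 'I_M -> R) :
  (forall j, 0 <= w j)%R -> (\sum_j w j = 1)%R ->
  \int[mu]_x (\sum_j w j * fs j x)%:E = 1.
Proof.
move=> w0 w1; rewrite (@integral_lincomb _ _ _ _ _ _ (fun=> 1%R))//.
- by under eq_bigr do rewrite mulr1; rewrite w1.
- by move=> j x; exact: pdf_ge0.
- by move=> j; exact: measurable_pdf.
- by move=> j; exact: integral_pdf.
Qed.

Definition exp_weights_density n (xs : n.-tuple T) : density mu :=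
  Density
    (measurableT_comp (@measurable_exp_weights_aggregate n) (pair1_measurable xs))
    (exp_weights_aggregate_ge0 xs) 
    (integral_convex_combination (averaged_weight_ge0 xs)
      (sum_averaged_weight xs)).

Definition exp_weights_estimator n : estimator mu n :=
  @Estimator _ _ _ _ n (@exp_weights_density n)
    (@measurable_exp_weights_aggregate n).

End gibbs.

(** * Cumulative divergence of the successive mixtures *)

Section gibbs_risk.
Local Open Scope ereal_scope.
Context d (T : measurableType d) (R : realType).
Variable mu : {sigma_finite_measure set T -> \bar R}.
Variables (M : nat) (fs : 'I_M -> density mu) (f : density mu) (j : 'I_M).
Implicit Type pi : 'I_M -> R.

Let M_gt0 : (0 < M)%N. Proof. exact: leq_ltn_trans (ltn_ord j). Qed.

(* [- ln] of the normalised prior mass of [j] *)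
Definition prior_cost pi : \bar R :=
  if pi j == 0%R then +oo else (ln ((\sum_l pi l) / pi j))%:E.

(** Written with [kl_term] rather than [KL] because the mixture is a bare function here, not
    packaged as a [density]. *)
Definition gibbs_divergence pi n (xs : n.-tuple T) k : \bar R :=
  \int[mu]_x kl_term (f x) (gibbs_mixture fs pi xs k x).

Definition gibbs_risk pi n (xs : n.-tuple T) : \bar R :=
  \sum_(k < n.+1) gibbs_divergence pi xs k.

Lemma prior_cost_ge0 pi : (forall l, 0 <= pi l)%R -> 0 <= prior_cost pi.
Proof.
move=> pi0; rewrite /prior_cost; case: ifPn => // pij.
rewrite lee_fin ln_ge0// (bigD1 j)//= mulrDl divff// lerDl.
by rewrite divr_ge0// sumr_ge0.
Qed.

Let kl_mixture_ge0 pi n (xs : n.-tuple T) k x : (forall l, 0 <= pi l)%R ->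
  0 <= kl_term (f x) (gibbs_mixture fs pi xs k x).
Proof. by move=> pi0; rewrite kl_term_ge0 ?pdf_ge0 ?gibbs_mixture_ge0. Qed.

Lemma gibbs_divergence_ge0 pi n (xs : n.-tuple T) k : (forall l, 0 <= pi l)%R ->
  0 <= gibbs_divergence pi xs k.
Proof. by move=> pi0; apply: integral_ge0 => x _; exact: kl_mixture_ge0. Qed.

Lemma gibbs_risk_ge0 pi n (xs : n.-tuple T) : (forall l, 0 <= pi l)%R ->
  0 <= gibbs_risk pi xs.
Proof. by move=> pi0; apply: sume_ge0 => k _; exact: gibbs_divergence_ge0. Qed.

Lemma measurable_gibbs_divergence pi n k : (forall l, 0 <= pi l)%R ->
  measurable_fun [set: n.-tuple T]
    (fun xs : n.-tuple T => gibbs_divergence pi xs k).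
Proof.
move=> pi0.
apply: (measurable_fun_fubini_tonelli_F (m2 := mu)
  (fun p : n.-tuple T * T => kl_term (f p.2) (gibbs_mixture fs pi p.1 k p.2))).
  apply: measurable_kl_term; last exact: measurable_gibbs_mixture.
  exact: (measurableT_comp (measurable_pdf f) measurable_snd).
by move=> p; exact: kl_mixture_ge0.
Qed.

Lemma measurable_gibbs_risk pi n : (forall l, 0 <= pi l)%R ->
  measurable_fun [set: n.-tuple T] (fun xs : n.-tuple T => gibbs_risk pi xs).
Proof.
by move=> pi0; apply: emeasurable_sum => k; exact: measurable_gibbs_divergence.
Qed.

Definition posterior pi x : 'I_M -> R := fun l => (pi l * fs l x)%R.

Lemma posterior_ge0 pi x : (forall l, 0 <= pi l)%R ->
  forall l, (0 <= posterior pi x l)%R.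
Proof. by move=> pi0 l; rewrite mulr_ge0 ?pdf_ge0. Qed.

(** The initial mixture uses no observation, so the sample may be exchanged for one of any size, in
    particular the empty one. *)
Lemma gibbs_divergence0 pi m (xs : m.-tuple T) n (ys : n.-tuple T) :
  gibbs_divergence pi xs 0 = gibbs_divergence pi ys 0.
Proof.
apply: eq_integral => x _; congr (kl_term _ _); apply: eq_bigr => l _.
rewrite /gibbs_weight !likelihood0; congr (_ * _)%R.
have e p (zs : p.-tuple T) : (\sum_i pi i * likelihood fs zs 0 i = \sum_i pi i)%R.
  by apply: eq_bigr => i _; rewrite likelihood0 mulr1.
by rewrite !e.
Qed.

Lemma gibbs_riskS pi n x (ys : n.-tuple T) :
  gibbs_risk pi (tcons (x, ys)) =
  gibbs_divergence pi [tuple] 0 + gibbs_risk (posterior pi x) ys.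
Proof.
rewrite /gibbs_risk big_ord_recl; congr (_ + _).
  exact: gibbs_divergence0.
apply: eq_bigr => k _; apply: eq_integral => y _; congr (kl_term _ _).
by apply: eq_bigr => l _; rewrite gibbs_weightS.
Qed.

Lemma measurable_prior_cost pi :
  measurable_fun [set: T] (fun x => prior_cost (posterior pi x)).
Proof.
have mp l : measurable_fun [set: T] (fun x => posterior pi x l).
  by apply: measurable_funM => //; exact: measurable_pdf.
apply: measurable_fun_ifT => //; first exact: measurable_fun_eqr.
apply/measurable_EFinP; apply: (measurableT_comp (@measurable_ln R)).
apply: measurable_funM; first exact: measurable_sum.
by apply: (measurableT_comp (@measurable_inv R)).
Qed.

(* Bayes' rule: with [m] the prior mixture, the posterior mass of [j] is
   [pi j * fs j / m]; the chain rule for [ln] does the rest. *)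
Lemma kl_term_posterior pi n (xs : n.-tuple T) x :
  (forall l, 0 <= pi l)%R -> (0 < pi j)%R ->
  kl_term (f x) (gibbs_mixture fs pi xs 0 x) +
    (f x)%:E * prior_cost (posterior pi x) + (fs j x)%:E <=
  (f x)%:E * prior_cost pi + kl_term (f x) (fs j x) +
    (gibbs_mixture fs pi xs 0 x)%:E.
Proof.
move=> pi0 pij.
have S0 : (0 < \sum_l pi l)%R.
  by rewrite (bigD1 j)//= ltr_pwDl// sumr_ge0.
rewrite gibbs_mixture0 ?gt_eqF// /prior_cost /posterior (gt_eqF pij).
set S := (\sum_l pi l)%R in S0 *; set m := (\sum_l _)%R.
have m0 : (0 <= m)%R by rewrite sumr_ge0// => l _; rewrite mulr_ge0 ?pdf_ge0.
have jm : (pi j * fs j x <= m)%R.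
  rewrite /m (bigD1 j)//= lerDl sumr_ge0// => l _.
  by rewrite mulr_ge0 ?pdf_ge0.
have := pdf_ge0 f x; rewrite le_eqVlt => /predU1P[<-|a0].
  by rewrite !kl_term0l !mul0e adde0 add0e addeC.
have := pdf_ge0 (fs j) x; rewrite le_eqVlt => /predU1P[<-|b0].
  by rewrite kl_term_pos0// -EFinM addey// addye// leey.
have {}m0 : (0 < m)%R by rewrite (lt_le_trans _ jm)// mulr_gt0.
rewrite mulf_eq0 !gt_eqF//= !kl_term_pos ?divr_gt0//.
rewrite -!EFinM -!EFinD lee_fin !ln_div ?posrE ?divr_gt0 ?mulr_gt0//.
rewrite lnM ?posrE//; lra.
Qed.

(** Integrates [kl_term_posterior]; the additional terms there, a density and a mixture of
    densities, both have integral one. *)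
Lemma gibbs_divergence_posterior pi n (xs : n.-tuple T) :
  (forall l, 0 <= pi l)%R -> (0 < pi j)%R ->
  gibbs_divergence pi xs 0 + \int[mu]_x ((f x)%:E * prior_cost (posterior pi x))
  <= prior_cost pi + \int[mu]_x kl_term (f x) (fs j x).
Proof.
move=> pi0 pij.
have f0 (g : density mu) x : 0 <= (g x)%:E by rewrite lee_fin pdf_ge0.
have mf := measurable_pdf_EFin.
have c0 := prior_cost_ge0 pi0.
have cx0 x : 0 <= prior_cost (posterior pi x).
  exact/prior_cost_ge0/posterior_ge0.
have mm : measurable_fun [set: T] (gibbs_mixture fs pi xs 0).
  exact: (measurableT_comp (measurable_gibbs_mixture fs pi 0) (pair1_measurable xs)).
have mk : measurable_fun [set: T]
    (fun x => kl_term (f x) (gibbs_mixture fs pi xs 0 x)).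
  by apply: measurable_kl_term => //; exact: measurable_pdf.
have mkj : measurable_fun [set: T] (fun x => kl_term (f x) (fs j x)).
  by apply: measurable_kl_term => //; exact: measurable_pdf.
have kj0 x : 0 <= kl_term (f x) (fs j x) by rewrite kl_term_ge0 ?pdf_ge0.
have km0 x := @kl_mixture_ge0 pi n xs 0 x pi0.
have mc : measurable_fun [set: T] (fun x => (f x)%:E * prior_cost (posterior pi x)).
  by apply: emeasurable_funM; [exact: mf|exact: measurable_prior_cost].
(* The [1] added on each side becomes the integral of [fs j] on the left and of the mixture on the
   right, so that only nonnegative integrands are compared. *)
rewrite -(@leeD2rE _ 1)//.
have im : \int[mu]_x (gibbs_mixture fs pi xs 0 x)%:E = 1.
  apply: integral_convex_combination => [l|]; first exact: gibbs_weight_ge0.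
  exact: sum_gibbs_weight.
rewrite -{1}(integral_pdf (fs j)) -im.
have -> : prior_cost pi = \int[mu]_x ((f x)%:E * prior_cost pi).
  under eq_integral do rewrite muleC.
  by rewrite ge0_integralZl ?integral_pdf ?mule1//; exact: mf.
have mfc : measurable_fun [set: T] (fun x => (f x)%:E * prior_cost pi).
  by apply: emeasurable_funM => //; exact: mf.
have fc0 x : 0 <= (f x)%:E * prior_cost pi by rewrite mule_ge0.
have fcx0 x : 0 <= (f x)%:E * prior_cost (posterior pi x) by rewrite mule_ge0.
have mmE := (measurable_EFinP _ _).2 mm.
have m0 x : 0 <= (gibbs_mixture fs pi xs 0 x)%:E by rewrite lee_fin gibbs_mixture_ge0.
rewrite -!ge0_integralD//; try exact: mf.
- apply: le_integral_ge0 => x; first by rewrite !adde_ge0.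
  exact: kl_term_posterior.
- by move=> x _; rewrite adde_ge0.
- exact: emeasurable_funD.
- by move=> x _; rewrite adde_ge0.
- exact: emeasurable_funD.
Qed.

(** Induction on [n] for all priors at once, since the first observation replaces the prior by the
    posterior. The expected posterior cost left by the induction hypothesis, together with the first
    divergence, is at most the prior cost plus one more [D]. *)
Theorem integral_gibbs_risk_le pi n : (forall l, 0 <= pi l)%R ->
  \int[sample_law f n]_xs gibbs_risk pi xs <=
  prior_cost pi + n.+1%:R%:E * \int[mu]_x kl_term (f x) (fs j x).
Proof.
set D := \int[mu]_x kl_term (f x) (fs j x).
have D0 : 0 <= D by apply: integral_ge0 => x _; rewrite kl_term_ge0 ?pdf_ge0.
have nD0 k : 0 <= k%:R%:E * D by rewrite mule_ge0// lee_fin.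
have step p m (xs : m.-tuple T) : (forall l, 0 <= p l)%R -> (0 < p j)%R ->
    gibbs_divergence p xs 0 +
      \int[mu]_x ((f x)%:E * prior_cost (posterior p x)) <= prior_cost p + D.
  exact: gibbs_divergence_posterior.
have c0 p x : (forall l, 0 <= p l)%R -> 0 <= prior_cost (posterior p x).
  by move=> p0; exact/prior_cost_ge0/posterior_ge0.
have f0 x : 0 <= (f x)%:E by rewrite lee_fin pdf_ge0.
elim: n pi => [|n IH] pi pi0.
all: have [pij|pij] := eqVneq (pi j) 0%R.
(* A prior without mass at [j] has infinite cost, so the bound is trivial. *)
1, 3: by rewrite /prior_cost pij eqxx addye ?leey// gt_eqF// (lt_le_trans _ (nD0 _)).
all: have {}pij : (0 < pi j)%R by rewrite lt0r pij pi0.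
  rewrite integral_product_power0.
  - rewrite /gibbs_risk big_ord1 mul1e.
    apply: (le_trans _ (step _ _ [tuple] pi0 pij)).
    by rewrite leeDl// integral_ge0// => x _; rewrite mule_ge0 ?c0.
  - exact: measurable_gibbs_risk.
  - by move=> xs; exact: gibbs_risk_ge0.
rewrite integral_sampleS//; last 2 first.
- exact: measurable_gibbs_risk.
- by move=> xs; exact: gibbs_risk_ge0.
(* The part of the conditional bound that does not depend on the first observation. *)
pose E := gibbs_divergence pi [tuple] 0 + n.+1%:R%:E * D.
have div0 := @gibbs_divergence_ge0 pi 0 [tuple] 0 pi0.
have E0 : 0 <= E by rewrite adde_ge0.
apply: (@le_trans _ _ (\int[mu]_x
    (E * (f x)%:E + (f x)%:E * prior_cost (posterior pi x)))).
  apply: le_integral_ge0 => x.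
    by rewrite mule_ge0// integral_ge0// => ys _; exact: gibbs_risk_ge0.
  rewrite (muleC E) -ge0_muleDr ?c0//; apply: lee_wpmul2l => //.
  under eq_integral do rewrite gibbs_riskS.
  rewrite ge0_integralD//; last 2 first.
  - by move=> ys _; apply: gibbs_risk_ge0; exact: posterior_ge0.
  - by apply: measurable_gibbs_risk; exact: posterior_ge0.
  rewrite integral_sample_cst// /E -(addeA (gibbs_divergence _ _ _)).
  apply: leeD2l; rewrite addeC.
  by apply: IH; exact: posterior_ge0.
rewrite ge0_integralD//; last 4 first.
- by move=> x _; rewrite mule_ge0.
- by apply: emeasurable_funM => //; exact: measurable_pdf_EFin.
- by move=> x _; rewrite mule_ge0 ?c0.
- apply: emeasurable_funM; first exact: measurable_pdf_EFin.
  exact: measurable_prior_cost.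
rewrite ge0_integralZl//; last exact: measurable_pdf_EFin.
rewrite integral_pdf mule1 /E addeAC.
apply: le_trans (leeD2r _ (step _ _ [tuple] pi0 pij)) _.
by rewrite -(addeA (prior_cost _)) -[n.+2%:R%R]nat1r EFinD ge0_muleDl ?mul1e ?lee_fin.
Qed.
End gibbs_risk.

(** * Oracle inequality for the exponential weights *)

Section oracle.
Local Open Scope ereal_scope.
Context d (T : measurableType d) (R : realType).
Variable mu : {sigma_finite_measure set T -> \bar R}.

Lemma measurable_KL_estimator (f : density mu) n (fhat : estimator mu n) :
  measurable_fun [set: n.-tuple T] (fun xs => KL mu f (fhat xs)).
Proof.
under eq_fun do rewrite KLE.
apply: (measurable_fun_fubini_tonelli_F (m2 := mu)
  (fun p : n.-tuple T * T => kl_term (f p.2) (fhat p.1 p.2))).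
  apply: measurable_kl_term; last exact: measurable_estimate.
  exact: (measurableT_comp (measurable_pdf f) measurable_snd).
by move=> p; rewrite kl_term_ge0 ?pdf_ge0.
Qed.

Variables (M : nat) (fs : 'I_M -> density mu) (M_gt0 : (0 < M)%N).

(** The aggregate is the mean of the [n.+1] successive mixtures, so Jensen's inequality applies
    pointwise before integration. *)
Lemma KL_exp_weights_le (f : density mu) n (xs : n.-tuple T) :
  n.+1%:R%:E * KL mu f (exp_weights_estimator fs M_gt0 n xs) <=
  gibbs_risk fs f (fun=> 1%R) xs.
Proof.
have mix0 k x : (0 <= gibbs_mixture fs (fun=> 1) xs k x)%R.
  exact: gibbs_mixture_ge0.
have mk k : measurable_fun [set: T]
    (fun x => kl_term (f x) (gibbs_mixture fs (fun=> 1%R) xs k x)).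
  apply: measurable_kl_term; first exact: measurable_pdf.
  exact: (measurableT_comp (measurable_gibbs_mixture _ _ k) (pair1_measurable xs)).
rewrite KLE -ge0_integralZl_EFin//; last 2 first.
- by move=> x _; rewrite kl_term_ge0 ?pdf_ge0.
- by apply: measurable_kl_term; exact: measurable_pdf.
rewrite /gibbs_risk -ge0_integral_sum//; last first.
  by move=> k x _; rewrite kl_term_ge0 ?pdf_ge0.
apply: le_integral_ge0 => x.
  by rewrite mule_ge0 ?kl_term_ge0 ?pdf_ge0 ?lee_fin.
by rewrite /= exp_weights_aggregateE kl_term_mean ?pdf_ge0.
Qed.

Lemma exp_weights_oracle (f : density mu) n j :
  \int[sample_law f n]_xs KL mu f (exp_weights_estimator fs M_gt0 n xs) <=
  (ln M%:R / n.+1%:R)%:E + KL mu f (fs j).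
Proof.
have n0 : (0 < n.+1%:R :> R)%R by [].
rewrite -(@lee_pmul2l _ n.+1%:R%:E)//.
rewrite -ge0_integralZl_EFin//; last 2 first.
- by move=> xs _; exact: KL_ge0.
- exact: measurable_KL_estimator.
apply: (@le_trans _ _ (\int[sample_law f n]_xs gibbs_risk fs f (fun=> 1%R) xs)).
  apply: le_integral_ge0 => xs; last exact: KL_exp_weights_le.
  by rewrite mule_ge0 ?KL_ge0// lee_fin.
apply: le_trans (integral_gibbs_risk_le fs f j n _) _ => //.
rewrite -KLE ge0_muleDr ?KL_ge0//; last first.
  by rewrite lee_fin divr_ge0// ln_ge0// ler1n.
(* The prior equal to [1] everywhere has total mass [M], hence cost [ln M]. *)
rewrite /prior_cost oner_eq0 divr1 sumr_const card_ord -EFinM.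
by rewrite mulrCA divff ?mulr1// gt_eqF.
Qed.

Lemma exp_weights_excess_risk_le (f : density mu) n :
  excess_risk (KL mu) fs (exp_weights_estimator fs M_gt0 n) f <=
  (ln M%:R / n.+1%:R)%:E.
Proof.
rewrite /excess_risk.
have [j ->] : exists j, \big[mine/+oo]_(i < M) KL mu f (fs i) = KL mu f (fs j).
  have [j _ ->] := eq_bigmin (Ordinal M_gt0) xpredT _ isT
    (fun i _ => leey (KL mu f (fs i))).
  by exists j.
have := exp_weights_oracle f n j.
have := KL_ge0 f (fs j).
case: (KL mu f (fs j)) => [r _ h|_ _|//]; first by rewrite leeBlDr.
(* An infinite minimum makes the excess risk [-oo]. *)
by rewrite addeNy leNye.
Qed.

End oracle.

Lemma attains_rate_exp_weights d (T : measurableType d) (R : realType)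
    (mu : {sigma_finite_measure set T -> \bar R}) (F : set (density mu)) M
    (fs : 'I_M -> density mu) (M_gt0 : (0 < M)%N) :
  attains_rate F (KL mu) (fun n M => ln (M%:R : R) / n%:R) 1 fs
    (exp_weights_estimator fs M_gt0).
Proof.
move=> n n0; apply: ge_ereal_sup => _ [f _ <-].
apply: le_trans (exp_weights_excess_risk_le _ _ _ _) _.
rewrite mul1r lee_fin ler_wpM2l ?ln_ge0 ?ler1n//.
(* The oracle bound has denominator [n.+1]; enlarging it to the rate only needs
   [1 / n.+1 <= 1 / n]. *)
by rewrite lef_pV2 ?posrE ?ltr0n// ler_nat.
Qed.

(** * Perturbations of the uniform density *)

Section signs.
Context {R : realType} {M : nat}.
Implicit Types (i j l : 'I_M) (S : {set 'I_M}).

Definition sign j S : R := if j \in S then 1 else -1.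

(** The symmetric difference with the singleton of [j]: it flips the [j]-th sign. *)
Definition toggle j S : {set 'I_M} := [set l | (l \in S) (+) (l == j)].

Lemma toggleK j : involutive (toggle j).
Proof. by move=> S; apply/setP => l; rewrite !inE -addbA addbb addbF. Qed.

Lemma sign_toggle i j S : sign i (toggle j S) = if i == j then - sign i S else sign i S.
Proof.
rewrite /sign inE; case: eqP => _; last by rewrite addbF.
by rewrite addbT; case: (i \in S); rewrite ?opprK.
Qed.

Lemma sqr_sign j S : sign j S ^+ 2 = 1.
Proof. by rewrite /sign; case: ifP; rewrite ?sqrrN expr1n. Qed.

(** Reindexing by the involution [toggle j] shows that the sum equals its own opposite. *)
Lemma sum_eq0_toggle j (F : {set 'I_M} -> R) :
  (forall S, F (toggle j S) = - F S) -> \sum_S F S = 0.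
Proof.
move=> FN; have : \sum_S F S = - \sum_S F S.
  rewrite -sumrN (reindex_inj (inv_inj (toggleK j))).
  by apply: eq_bigr => S _.
lra.
Qed.

Lemma sum_sign j : \sum_S sign j S = 0.
Proof. by apply: (sum_eq0_toggle (j := j)) => S; rewrite sign_toggle eqxx. Qed.

Lemma sum_sign_mul i j : i != j -> \sum_S sign i S * sign j S = 0.
Proof.
move=> ij; apply: (sum_eq0_toggle (j := j)) => S.
by rewrite !sign_toggle eqxx (negbTE ij) mulrN.
Qed.

End signs.

(** * Functions constant on disjoint cells of equal measure *)

Section cells.
Context d (T : measurableType d) (R : realType).
Variable mu : {measure set T -> \bar R}.

(** For nonempty [I] the total measure is one. The cells need not cover the space, and functions
    built on them vanish elsewhere. *)
Definition cells (I : finType) (B : I -> set T) :=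
  [/\ forall i, measurable (B i), forall i j x, B i x -> B j x -> i = j &
      forall i, mu (B i) = (#|I|%:R^-1)%:E].

Definition cell_fun (I : finType) (B : I -> set T) (c : I -> R) (x : T) : R :=
  \sum_i c i * \1_(B i) x.

Variables (I : finType) (B : I -> set T).
Hypothesis cB : cells B.

(** The index depends on [x] alone, not on [c]: pointwise relations between several cell functions
    reduce to relations between their coefficients. *)
Lemma cell_funP x :
  (forall c, cell_fun B c x = 0) \/ exists i, forall c, cell_fun B c x = c i.
Proof.
have [mB dB _] := cB.
have [[i Bix]|nB] := pselect (exists i, B i x); [right|left].
  exists i => c; rewrite /cell_fun (bigD1 i)//= indicE mem_set// mulr1.
  rewrite big1 ?addr0// => j ji; rewrite indicE memNset ?mulr0// => Bjx.
  by move: ji; rewrite (dB _ _ _ Bjx Bix) eqxx.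
move=> c; rewrite /cell_fun big1// => j _.
by rewrite indicE memNset ?mulr0// => Bjx; apply: nB; exists j.
Qed.

Lemma cell_fun_ge0 c : (forall i, 0 <= c i) -> forall x, 0 <= cell_fun B c x.
Proof. by move=> c0 x; case: (cell_funP x) => [->//|[i ->]]. Qed.

Lemma measurable_cell_fun c : measurable_fun [set: T] (cell_fun B c).
Proof.
have [mB _ _] := cB.
by apply: measurable_sum => i; apply: measurable_funM.
Qed.

Lemma integral_cell_fun c : (forall i, 0 <= c i) ->
  (\int[mu]_x (cell_fun B c x)%:E = (#|I|%:R^-1 * \sum_i c i)%:E)%E.
Proof.
have [mB _ muB] := cB.
move=> c0; rewrite (@integral_lincomb _ _ _ _ _ _ (fun=> #|I|%:R^-1))//.
- by rewrite -mulr_suml mulrC.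
- by move=> i; apply/measurable_indic.
- by move=> i; rewrite integral_indic// setIT.
Qed.

End cells.

(** * Densities indexed by the coordinates of a hypercube of cells *)

Section hypercube.
Context d (T : measurableType d) (R : realType).
Variable mu : {sigma_finite_measure set T -> \bar R}.
Variables (M : nat) (B : {set 'I_M} -> set T).
Hypothesis cB : cells mu B.
Variable delta : R.
Hypothesis delta0 : 0 <= delta.
Hypothesis delta2 : delta <= 2^-1.

Let N : R := #|{set 'I_M}|%:R.
Let N0 : 0 < N.
Proof. by rewrite ltr0n; apply/card_gt0P; exists finset.set0. Qed.

Let sum1 : \sum_(S : {set 'I_M}) (1 : R) = N.
Proof. by rewrite sumr_const. Qed.

Definition vertex j (S : {set 'I_M}) : R := 1 + delta * sign j S.

Let vertex_bounds j S : 2^-1 <= vertex j S <= 1 + delta.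
Proof.
have d0 := delta0; have d2 := delta2.
by rewrite /vertex /sign; case: ifP => _; apply/andP; split; lra.
Qed.

Let vertex_ge0 j S : 0 <= vertex j S.
Proof. by have /andP[+ _] := vertex_bounds j S; lra. Qed.

Lemma integral_vertex j : (\int[mu]_x (cell_fun B (vertex j) x)%:E = 1)%E.
Proof.
rewrite integral_cell_fun// big_split/= sum1 -mulr_sumr sum_sign mulr0 addr0.
by rewrite mulVf// gt_eqF.
Qed.

Definition hypercube_density j : density mu :=
  Density (measurable_cell_fun cB (vertex j)) (cell_fun_ge0 cB (vertex_ge0 j))
    (integral_vertex j).

(** The density of the uniform law on the union of the cells; every hypercube density vanishes where
    it does. *)
Definition cell_indicator : T -> R := cell_fun B (fun=> 1).

Lemma integral_cell_indicator : (\int[mu]_x (cell_indicator x)%:E = 1)%E.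
Proof. by rewrite integral_cell_fun// sum1 mulVf// gt_eqF. Qed.

Lemma hypercube_density_le j x : hypercube_density j x <= 1 + delta.
Proof.
rewrite /=; case: (cell_funP cB x) => [->|[S ->]]; first by have := delta0; lra.
by have /andP[] := vertex_bounds j S.
Qed.

Lemma cell_indicator01 x : cell_indicator x = 1 \/
  cell_indicator x = 0 /\ forall j, hypercube_density j x = 0.
Proof.
by rewrite /cell_indicator /=; case: (cell_funP cB x) => [e|[S e]]; [right|left].
Qed.

Lemma integral_sqr_hypercube j :
  (\int[mu]_x (hypercube_density j x ^+ 2)%:E = (1 + delta ^+ 2)%:E)%E.
Proof.
transitivity (\int[mu]_x (cell_fun B (fun S => vertex j S ^+ 2) x)%:E)%E.
  apply: eq_integral => x _ /=; case: (cell_funP cB x) => [e|[S e]].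
    by rewrite !e expr0n.
  by rewrite !e.
rewrite (integral_cell_fun cB); last by move=> S; rewrite sqr_ge0.
have -> : \sum_S vertex j S ^+ 2 =
    \sum_S ((1 + delta ^+ 2) * 1 + 2 * delta * sign j S).
  apply: eq_bigr => S _; rewrite /vertex sqrrD exprMn sqr_sign; ring.
rewrite big_split/= -!mulr_sumr sum_sign sum1 mulr0 addr0 mulrCA mulVf ?mulr1//.
by rewrite gt_eqF.
Qed.

(** Factor [a - b] as a difference of squares of roots; the squared sum of the roots is at most
    [2 * (a + b) <= 6]. *)
Lemma sqr_sqrt_sub_ge (a b : R) : 0 <= a -> 0 <= b -> a + b <= 3 ->
  (a - b) ^+ 2 / 6 <= (Num.sqrt a - Num.sqrt b) ^+ 2.
Proof.
move=> a0 b0; have [u0 v0] : 0 <= Num.sqrt a /\ 0 <= Num.sqrt b.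
  by rewrite !sqrtr_ge0.
move: (sqr_sqrtr a0) (sqr_sqrtr b0) u0 v0.
move: (Num.sqrt a) (Num.sqrt b) => u v <- <- u0 v0 uv.
rewrite ler_pdivrMr//.
have -> : (u ^+ 2 - v ^+ 2) ^+ 2 = (u - v) ^+ 2 * (u + v) ^+ 2 by ring.
rewrite ler_wpM2l ?sqr_ge0//.
have := sqr_ge0 (u - v); rewrite sqrrB sqrrD; lra.
Qed.

(** Distinct signs are orthogonal, so their squared difference has mean [2] over the cells, and
    [2 * delta ^+ 2 / 6] is the stated bound. *)
Lemma hellinger_hypercube i j : i != j ->
  ((delta ^+ 2 / 3)%:E <= \int[mu]_x
    ((Num.sqrt (hypercube_density i x) - Num.sqrt (hypercube_density j x)) ^+ 2)%:E)%E.
Proof.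
move=> ij; pose c S : R := delta ^+ 2 / 6 * (sign i S - sign j S) ^+ 2.
have c0 S : 0 <= c S by rewrite mulr_ge0 ?sqr_ge0// divr_ge0 ?sqr_ge0.
have -> : (delta ^+ 2 / 3)%:E = (\int[mu]_x (cell_fun B c x)%:E)%E.
  rewrite integral_cell_fun//; congr EFin.
  have -> : \sum_S c S =
      \sum_S (delta ^+ 2 / 3 * 1 - delta ^+ 2 / 3 * (sign i S * sign j S)).
    by apply: eq_bigr => S _; rewrite /c sqrrB !sqr_sign; field.
  rewrite sumrB -!mulr_sumr sum1 sum_sign_mul// mulr0 subr0 mulrCA mulVf ?mulr1//.
  by rewrite gt_eqF.
apply: le_integral_ge0 => x; first by rewrite lee_fin (cell_fun_ge0 cB).
rewrite lee_fin /=; case: (cell_funP cB x) => [e|[S e]]; rewrite !e ?sqr_ge0//.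
have /andP[_ vi] := vertex_bounds i S; have /andP[_ vj] := vertex_bounds j S.
apply: le_trans (sqr_sqrt_sub_ge _ _ _) => //; last by have := delta2; lra.
by rewrite le_eqVlt /c /vertex; apply/orP; left; apply/eqP; field.
Qed.

End hypercube.

(** * Lower bound *)

Section minimax.
Local Open Scope ereal_scope.
Context d (T : measurableType d) (R : realType).
Variable mu : {sigma_finite_measure set T -> \bar R}.

(* At most one [h j] is below [s], and it carries weight at most [w]. *)
Lemma sum_weight_le M (p : 'I_M -> R) (h : 'I_M -> \bar R) (s w : R) :
  (0 <= s)%R -> (forall j, 0 <= p j <= w)%R -> (0 <= w)%R ->
  (forall j, 0 <= h j) ->
  (forall i j, i != j -> s%:E <= h i \/ s%:E <= h j) ->
  (\sum_j s * p j)%:E <= \sum_j (p j)%:E * h j + (s * w)%:E.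
Proof.
move=> s0 pw w0 h0 hs.
have p0 j : (0 <= p j)%R by have /andP[] := pw j.
have sp j : s%:E <= h j -> (s * p j)%:E <= (p j)%:E * h j.
  by move=> sh; rewrite mulrC EFinM lee_wpmul2l// lee_fin.
have ph0 j : 0 <= (p j)%:E * h j by rewrite mule_ge0 ?lee_fin.
rewrite -sumEFin.
have [[j hj]|nh] := pselect (exists j, h j < s%:E); last first.
  apply: lee_paddr; first by rewrite lee_fin mulr_ge0.
  apply: lee_sum => j _; apply: sp; rewrite leNgt; apply/negP => hj.
  by apply: nh; exists j.
rewrite (bigD1 j)//= [in leRHS](bigD1 j)//= addeC -addeA.
apply: lee_paddl => //; apply: leeD.
  apply: lee_sum => i ij; apply: sp.
  by have [//|] := hs _ _ ij; rewrite leNgt hj.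
by rewrite lee_fin ler_wpM2l//; have /andP[] := pw j.
Qed.

Definition hellinger2 (f g : density mu) : \bar R :=
  \int[mu]_x ((Num.sqrt (f x) - Num.sqrt (g x)) ^+ 2)%:E.

Lemma hellinger2_ge0 f g : 0 <= hellinger2 f g.
Proof. by apply: integral_ge0 => x _; rewrite lee_fin sqr_ge0. Qed.

Lemma hellinger2_le_KL f g : hellinger2 f g <= KL mu f g.
Proof.
rewrite KLE; apply: le_integral_ge0 => x; first by rewrite lee_fin sqr_ge0.
by rewrite hellinger_le_kl_term ?pdf_ge0.
Qed.

Let msqrt d' (X : measurableType d') (g : X -> R) :
  measurable_fun [set: X] g ->
  measurable_fun [set: X] (fun x => Num.sqrt (g x)).
Proof.
move=> mg; apply: (@measurableT_comp _ _ _ _ _ _ (@Num.sqrt R)) => //.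
by apply: continuous_measurable_fun; exact: sqrt_continuous.
Qed.

Lemma measurable_hellinger2_estimator (f : density mu) n (fhat : estimator mu n) :
  measurable_fun [set: n.-tuple T] (fun xs => hellinger2 f (fhat xs)).
Proof.
apply: (measurable_fun_fubini_tonelli_F (m2 := mu) (fun p : n.-tuple T * T =>
  ((Num.sqrt (f p.2) - Num.sqrt (fhat p.1 p.2)) ^+ 2)%:E)).
  apply/measurable_EFinP; apply: measurable_funX; apply: measurable_funB.
    apply: msqrt; exact: (measurableT_comp (measurable_pdf f) measurable_snd).
  by apply: msqrt; exact: measurable_estimate.
by move=> p; rewrite lee_fin sqr_ge0.
Qed.

(** By [(a - b)^2 <= 2 (a - c)^2 + 2 (b - c)^2], a density [h] closer than [s] to both would put [f]
    and [g] closer than [4 * s]. *)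
Lemma hellinger2_separated (f g h : density mu) (s : R) :
  (4 * s)%:E <= hellinger2 f g ->
  s%:E <= hellinger2 f h \/ s%:E <= hellinger2 g h.
Proof.
move=> fg; have [|fh] := leP s%:E (hellinger2 f h); [by left|right].
rewrite leNgt; apply/negP => gh.
have mq (g1 g2 : density mu) : measurable_fun [set: T]
    (fun x => ((Num.sqrt (g1 x) - Num.sqrt (g2 x)) ^+ 2)%:E).
  apply/measurable_EFinP; apply: measurable_funX; apply: measurable_funB;
    by apply: msqrt; exact: measurable_pdf.
have q0 (g1 g2 : density mu) x :
    0 <= ((Num.sqrt (g1 x) - Num.sqrt (g2 x)) ^+ 2)%:E.
  by rewrite lee_fin sqr_ge0.
have : hellinger2 f g <= 2%:E * (hellinger2 f h + hellinger2 g h).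
  rewrite /hellinger2 -ge0_integralD// -ge0_integralZl_EFin//; last 2 first.
  - by move=> x _; rewrite adde_ge0.
  - exact: emeasurable_funD.
  apply: le_integral_ge0 => x //; rewrite -EFinD -EFinM lee_fin.
  move: (Num.sqrt (f x)) (Num.sqrt (g x)) (Num.sqrt (h x)) => a b c.
  have := sqr_ge0 (a - c + (b - c)); nra.
apply/negP; rewrite -ltNge (lt_le_trans _ fg)//.
have -> : (4 * s)%:E = 2%:E * (s%:E + s%:E).
  by rewrite -EFinD -EFinM; congr EFin; ring.
by rewrite lte_pmul2l// lteD.
Qed.

Variables (M : nat) (fs : 'I_M -> density mu) (g : T -> R) (s v : R).
Hypothesis s0 : (0 <= s)%R.
Hypothesis mg : measurable_fun [set: T] g.
Hypothesis g1 : \int[mu]_x (g x)%:E = 1.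
Hypothesis g01 : forall x, g x = 1%R \/ g x = 0%R /\ forall j, fs j x = 0%R.
Hypothesis fsv : forall j, \int[mu]_x (fs j x ^+ 2)%:E = v%:E.
Hypothesis fss : forall i j, i != j -> (4 * s)%:E <= hellinger2 (fs i) (fs j).

Variables (n : nat) (fhat : estimator mu n).

Let p j (xs : n.-tuple T) : R := (\prod_(i < n) fs j (tnth xs i))%R.
Let p0 (xs : n.-tuple T) : R := (\prod_(i < n) g (tnth xs i))%R.
Let nu := product_power mu n.

Let p_ge0 j xs : (0 <= p j xs)%R.
Proof. by apply: prodr_ge0 => i _; exact: pdf_ge0. Qed.

Let mp j : measurable_fun [set: n.-tuple T] (p j).
Proof. by apply/measurable_EFinP; exact: measurable_prod_tnth. Qed.

Let g0 x : (0 <= g x)%R.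
Proof. by case: (g01 x) => [->|[->]]. Qed.

(** A vanishing factor of [p0] comes with a vanishing factor of every likelihood. *)
Let p0_01 xs : p0 xs = 1%R \/ forall j, p j xs = 0%R.
Proof.
have [[i gi]|ng] := pselect (exists i, g (tnth xs i) = 0%R); [right|left].
  move=> j; apply/eqP/prodf_eq0; exists i => //; apply/eqP.
  by case: (g01 (tnth xs i)) => [|[]//]; rewrite gi => /esym/eqP; rewrite oner_eq0.
rewrite /p0 big1// => i _; case: (g01 (tnth xs i)) => // -[gi _].
by exfalso; apply: ng; exists i.
Qed.

(* Second moment method: by AM-GM the largest likelihood is at most
   [t / 2 + \sum_j p_j^2 / (2 t)]. *)
Lemma sum_hellinger2_risk_ge (t : R) : (0 < t)%R ->
  (s * M%:R)%:E <= \sum_j \int[sample_law (fs j) n]_xs hellinger2 (fs j) (fhat xs)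
    + (s * (t / 2 + M%:R * v ^+ n / (2 * t)))%:E.
Proof.
move=> t0.
(* [w] dominates every likelihood. The factor [p0] confines the constant [t / 2] to samples lying in
   the support of [g], which keeps its integral finite. *)
pose w xs := (t / 2 * p0 xs + \sum_j (2 * t)^-1 * p j xs ^+ 2)%R.
have p0_ge0 xs : (0 <= p0 xs)%R by apply: prodr_ge0.
have c0 : (0 <= (2 * t)^-1)%R by rewrite invr_ge0 mulr_ge0// ltW.
have w2 xs : (0 <= \sum_j (2 * t)^-1 * p j xs ^+ 2)%R.
  by apply: sumr_ge0 => j _; rewrite mulr_ge0 ?sqr_ge0.
have t2 : (0 <= t / 2)%R by rewrite divr_ge0// ltW.
have mp0 : measurable_fun [set: n.-tuple T] p0.
  apply: measurable_prod => i _.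
  by apply: (measurableT_comp mg); exact: measurable_tnth.
have mp2 j : measurable_fun [set: n.-tuple T] (fun xs => p j xs ^+ 2)%R.
  exact: measurable_funX.
have mw2 : measurable_fun [set: n.-tuple T]
    (fun xs => \sum_j (2 * t)^-1 * p j xs ^+ 2)%R.
  by apply: measurable_sum => j; exact: measurable_funM.
have w1 xs : (0 <= t / 2 * p0 xs)%R by exact: mulr_ge0.
have pw j xs : (p j xs <= w xs)%R.
  rewrite /w; case: (p0_01 xs) => [->|->]; last exact: addr_ge0.
  rewrite mulr1 (bigD1 j)//= addrA.
  rewrite -[leLHS]addr0 lerD//; last first.
    by apply: sumr_ge0 => i _; rewrite mulr_ge0 ?sqr_ge0.
  rewrite -subr_ge0 (_ : _ - _ = (2 * t)^-1 * (p j xs - t) ^+ 2)%R.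
    by rewrite mulr_ge0 ?sqr_ge0.
  by field; rewrite gt_eqF.
have w0 xs : (0 <= w xs)%R by exact: addr_ge0.
have int_w : \int[nu]_xs (s * w xs)%:E =
    (s * (t / 2 + M%:R * v ^+ n / (2 * t)))%:E.
  under eq_integral do rewrite EFinM EFinD.
  rewrite ge0_integralZl_EFin//; last 2 first.
  - by move=> xs _; rewrite -EFinD lee_fin; exact: w0.
  - by apply: emeasurable_funD; apply/measurable_EFinP => //; exact: measurable_funM.
  rewrite ge0_integralD//; last 4 first.
  - by move=> xs _; rewrite lee_fin.
  - by apply/measurable_EFinP; exact: measurable_funM.
  - by move=> xs _; rewrite lee_fin.
  - exact/measurable_EFinP.
  rewrite (@integral_lincomb _ _ _ _ _ _ (fun=> v ^+ n)%R)//; last 2 first.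
  - by move=> j xs; exact: sqr_ge0.
  - move=> j; under eq_integral do rewrite /p -prodrXl.
    apply: (@integral_prod_tnth _ _ _ mu n (fun x => fs j x ^+ 2)%R) => //.
    + by move=> x; exact: sqr_ge0.
    + by apply: measurable_funX; exact: measurable_pdf.
  under eq_integral do rewrite EFinM.
  rewrite ge0_integralZl_EFin//; last 2 first.
  - by move=> xs _; rewrite lee_fin.
  - exact/measurable_EFinP.
  rewrite (@integral_prod_tnth _ _ _ mu n g 1%R)// expr1n mule1.
  rewrite sumr_const card_ord -EFinD -EFinM; congr (_ * (_ + _))%:E.
  by rewrite -[LHS]mulr_natl mulrCA mulrC mulrAC.
have int_p : \int[nu]_xs (\sum_j s * p j xs)%:E = (s * M%:R)%:E.
  rewrite (@integral_lincomb _ _ _ _ _ _ (fun=> 1%R))//; last first.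
    move=> j; rewrite (@integral_prod_tnth _ _ _ mu n (fs j) 1%R) ?expr1n//.
    - exact: pdf_ge0.
    - exact: measurable_pdf.
    - exact: integral_pdf.
  by rewrite -mulr_sumr sumr_const card_ord.
have h0 j xs : 0 <= hellinger2 (fs j) (fhat xs) by exact: hellinger2_ge0.
have mh j := measurable_hellinger2_estimator (fs j) fhat.
have mph j : measurable_fun [set: n.-tuple T]
    (fun xs => (p j xs)%:E * hellinger2 (fs j) (fhat xs)).
  by apply: emeasurable_funM => //; exact/measurable_EFinP.
have ph0 j xs : 0 <= (p j xs)%:E * hellinger2 (fs j) (fhat xs).
  by rewrite mule_ge0// lee_fin.
(* With all the risks written over [nu], it suffices to prove the inequality for each sample. *)
rewrite -int_p -int_w; under eq_bigr do rewrite integral_sample_law//.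
rewrite -ge0_integral_sum//; last by move=> j xs _; exact: ph0.
rewrite -/nu -ge0_integralD//; last 4 first.
- by move=> xs _; apply: sume_ge0 => j _; exact: ph0.
- exact: emeasurable_sum.
- by move=> xs _; rewrite lee_fin mulr_ge0.
- apply/measurable_EFinP; apply: measurable_funM => //.
  by apply: measurable_funD => //; exact: measurable_funM.
apply: le_integral_ge0 => xs.
  by rewrite lee_fin sumr_ge0// => j _; rewrite mulr_ge0.
apply: sum_weight_le => // [j|i j ij]; first by rewrite p_ge0 pw.
exact: hellinger2_separated (fss ij).
Qed.

(** The bound is the average over [j] given by [sum_hellinger2_risk_ge]; the squared Hellinger risks
    cannot all lie strictly below it, and the divergence dominates them. *)
Lemma KL_risk_ge (t : R) : (0 < M)%N -> (0 < t)%R ->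
  exists j, (s * (1 - t / (2 * M%:R) - v ^+ n / (2 * t)))%:E <=
    \int[sample_law (fs j) n]_xs KL mu (fs j) (fhat xs).
Proof.
move=> M0 t0; set c := (s * _)%R; apply: contrapT => nex.
have hc j : \int[sample_law (fs j) n]_xs hellinger2 (fs j) (fhat xs) < c%:E.
  rewrite ltNge; apply/negP => cj; apply: nex; exists j; apply: le_trans cj _.
  by apply: le_integral_ge0 => xs; [exact: hellinger2_ge0|exact: hellinger2_le_KL].
have := sum_hellinger2_risk_ge t0; apply/negP; rewrite -ltNge.
have M0R : (0 < M%:R :> R)%R by rewrite ltr0n.
have -> : (s * M%:R)%:E = \sum_(j < M) c%:E + (s * (t / 2 + M%:R * v ^+ n / (2 * t)))%:E.
  rewrite sumEFin sumr_const card_ord -EFinD; congr EFin.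
  rewrite -[(c *+ M)%R]mulr_natl /c; field.
  by rewrite !gt_eqF.
rewrite lteD2rE//.
(* One index is isolated so that its strict inequality makes the comparison of sums strict. *)
rewrite (bigD1 (Ordinal M0))//= [ltRHS](bigD1 (Ordinal M0))//=.
apply: le_lt_trans.
  by apply: leeD2l; apply: (lee_sum _ (fun j _ => ltW (hc j))).
by rewrite lteD2rE// sumEFin.
Qed.

End minimax.

(** * Cells of equal Lebesgue measure *)

Lemma product_power_slab d (T : measurableType d) (R : realType)
    (mu : {sigma_finite_measure set T -> \bar R}) n (J : set T)
    (C : set (n.-tuple T)) : measurable J -> measurable C ->
  let S := [set t : n.+1.-tuple T | J (thead t) /\ C [tuple of behead t]] in
  measurable S /\ product_power mu n.+1 S = (mu J * product_power mu n C)%E.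
Proof.
move=> mJ mC S; split.
  apply: measurableI.
  - by rewrite -[X in measurable X]setTI; exact: measurable_tnth.
  - by rewrite -[X in measurable X]setTI; exact: measurable_behead.
(* The slab pulls back under [tcons] to the rectangle with sides [J] and [C]. *)
rewrite -(product_measure1E mu (product_power mu n))//.
rewrite /= /prepend /pushforward; congr product_measure1.
have bK (p : T * n.-tuple T) : [tuple of behead (tcons p)] = p.2 by exact/val_inj.
by apply/seteqP; split => p; rewrite /S /= bK.
Qed.

Section lebesgue_cells.
Context (R : realType).
Local Notation leb := (@lebesgue_measure R).

Lemma product_power_unit_cube n : exists2 C : set (n.-tuple (measurableTypeR R)),
  measurable C & product_power leb n C = 1%E.
Proof.
elim: n => [|n [C mC C1]].
  by exists setT => //; rewrite /= diracE mem_set.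
pose J : set (measurableTypeR R) := `[0%R, 1%R[%classic.
have mJ : measurable J by exact: measurable_itv.
have [mS SE] := product_power_slab leb mJ mC.
eexists; [exact: mS|rewrite SE C1 mule1].
suff : lebesgue_measure J = 1%E by [].
by rewrite /J lebesgue_measure_itv/= lte_fin ltr01 oppr0 adde0.
Qed.

(** A unit cube is cut into [#|I|] slabs of equal width along its first axis, one for each rank in
    the enumeration of [I]. *)
Lemma lebesgue_cells d (I : finType) : (0 < d)%N -> (0 < #|I|)%N ->
  exists B : I -> set (d.-tuple (measurableTypeR R)), cells (lebesgue_Rd R d) B.
Proof.
case: d => // d _ I0.
have [C mC C1] := product_power_unit_cube d.
have N0 : 0 < #|I|%:R :> R by rewrite ltr0n.
pose J (i : I) : set (measurableTypeR R) :=
  `[((enum_rank i : nat)%:R / #|I|%:R : R),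
    ((enum_rank i : nat).+1%:R / #|I|%:R : R)[%classic.
have mJ i : measurable (J i) by exact: measurable_itv.
pose B i := [set t : d.+1.-tuple (measurableTypeR R) |
  J i (thead t) /\ C [tuple of behead t]].
exists B; split.
- by move=> i; have [] := product_power_slab leb (mJ i) mC.
- move=> i j x [+ _] [+ _]; rewrite /J /= !in_itv/= => /andP[i1 i2] /andP[j1 j2].
  apply/enum_rank_inj/val_inj/eqP => /=.
  (* Half-open intervals with a common point have ranks each below the successor of the other, hence
     equal ranks. *)
  have ij := le_lt_trans i1 j2; have ji := le_lt_trans j1 i2.
  move: ij ji; rewrite !ltr_pM2r ?invr_gt0// !ltr_nat !ltnS => ij ji.
  by rewrite eqn_leq ij ji.
- move=> i; apply: etrans (product_power_slab leb (mJ i) mC).2 _.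
  rewrite C1 mule1.
  suff : lebesgue_measure (J i) = (#|I|%:R^-1)%:E by [].
  rewrite /J lebesgue_measure_itv/= lte_fin ltr_pM2r ?invr_gt0// ltr_nat.
  by rewrite ltnS leqnn -EFinB -mulrBl -natrB// subSnn mul1r.
Qed.

End lebesgue_cells.

(** * Lower bound on the excess risk *)

Section lower_bound.
Context d (T : measurableType d) (R : realType).
Variable mu : {sigma_finite_measure set T -> \bar R}.

(** When the true density is one of the [fs], the minimum is at most [KL_self], that is zero. *)
Lemma KL_excess_risk_ge M (fs : 'I_M -> density mu) n (fhat : estimator mu n) j :
  (\int[sample_law (fs j) n]_xs KL mu (fs j) (fhat xs) <=
   excess_risk (KL mu) fs fhat (fs j))%E.
Proof.
rewrite /excess_risk; apply: lee_paddr => //.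
rewrite oppe_ge0 -(KL_self (fs j)); exact: bigmin_le_cond.
Qed.

Lemma aggregation_lower_bound (A : R) (M n : nat) : 1 < A -> (2 <= M)%N -> (0 < n)%N ->
  (exists B : {set 'I_M} -> set T, cells mu B) ->
  ln M%:R <= 16 * Num.min 1 (A - 1) ^+ 2 * n%:R ->
  exists2 fs : 'I_M -> density mu, (forall i, bounded_densities mu A (fs i)) &
  forall fhat : estimator mu n,
    (((1 - expR (- ln 2 / 4)) / 768 * (ln M%:R / n%:R))%:E <=
      sup_excess_risk (bounded_densities mu A) (KL mu) fs fhat)%E.
Proof.
move=> A1 M2 n0 [B cB] regime; set L := ln M%:R in regime *.
have nR : 0 < n%:R :> R by rewrite ltr0n.
have MR : 0 < M%:R :> R by rewrite ltr0n (leq_trans _ M2).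
have L2 : ln 2 <= L by rewrite ler_ln ?posrE// ler_nat.
have L0 : 0 < L by rewrite (lt_le_trans _ L2)// ln_gt0// ltr1n.
have ML : M%:R = expR L by rewrite lnK.
set m := Num.min 1 (A - 1) in regime.
have m0 : 0 < m by rewrite lt_min ltr01 subr_gt0.
(* The regime gives [delta <= m / 2]: hence [delta <= 1 / 2], which keeps the densities positive on
   the cells, and [1 + delta <= A]. *)
pose delta := Num.sqrt (L / (64 * n%:R)).
have delta0 : 0 <= delta by exact: sqrtr_ge0.
have deltaE : delta ^+ 2 = L / (64 * n%:R).
  by rewrite sqr_sqrtr// divr_ge0 ?mulr_ge0 ?ltW.
have deltam : delta <= m / 2.
  have m20 : 0 <= m / 2 by lra.
  rewrite -(@ler_pXn2r _ 2)// ?nnegrE// deltaE.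
  rewrite ler_pdivrMr ?mulr_gt0//; apply: le_trans regime _.
  by rewrite le_eqVlt; apply/orP; left; apply/eqP; field.
have m1 : m <= 1 by rewrite ge_min lexx.
have mA : m <= A - 1 by rewrite ge_min lexx orbT.
have delta2 : delta <= 2^-1 by lra.
pose fs := hypercube_density cB delta0 delta2.
have fsA i : bounded_densities mu A (fs i).
  by move=> x; apply: le_trans (hypercube_density_le cB delta0 delta2 i x) _; lra.
exists fs => // fhat.
(* The number [768] is [64 * 3 * 4]: the separation [delta ^+ 2 / 3] must be four times [s]. *)
have sep i j : i != j ->
    ((4 * (L / (768 * n%:R)))%:E <= hellinger2 (fs i) (fs j))%E.
  move=> ij; apply: le_trans (hellinger_hypercube cB delta0 delta2 ij).
  rewrite lee_fin deltaE le_eqVlt; apply/orP; left; apply/eqP; field.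
  by rewrite gt_eqF.
have s0 : 0 <= L / (768 * n%:R).
  by apply: divr_ge0; [exact: ltW|apply: mulr_ge0; rewrite ler0n].
(* The parameter [t] is [expR (L / 2)], the square root of [M]; each of the two subtracted terms is
   then at most half of [2^(-1/4)], because [M >= 2]. *)
have [j hj] := KL_risk_ge s0 (measurable_cell_fun cB _)
  (integral_cell_indicator cB) (cell_indicator01 cB delta0 delta2)
  (integral_sqr_hypercube cB delta0 delta2) sep fhat (leq_trans (isT : 0 < 2)%N M2)
  (expR_gt0 (L / 2)).
apply: (@le_trans _ _ (excess_risk (KL mu) fs fhat (fs j))); last first.
  by apply: ereal_sup_ubound; exists (fs j).
apply: le_trans (KL_excess_risk_ge fs fhat j); apply: le_trans hj.
have e1 : expR (L / 2) / (2 * M%:R) <= expR (- ln 2 / 4) / 2.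
  rewrite ML invfM mulrA mulrAC -expRN -expRD ler_pM2r// ler_expR; lra.
have e2 : (1 + delta ^+ 2) ^+ n / (2 * expR (L / 2)) <= expR (- ln 2 / 4) / 2.
  rewrite invfM mulrA mulrAC -expRN ler_pM2r//.
  apply: (@le_trans _ _ (expR (L / 64) * expR (- (L / 2)))); last first.
    by rewrite -expRD ler_expR; lra.
  rewrite ler_pM2r ?expR_gt0//.
  (* By [1 + y <= expR y], with [n * delta ^+ 2 = L / 64]. *)
  apply: (@le_trans _ _ (expR (delta ^+ 2) ^+ n)).
    by rewrite lerXn2r ?nnegrE ?expR_ge0 ?addr_ge0 ?sqr_ge0// expR_ge1Dx.
  rewrite -expRM_natl ler_expR deltaE le_eqVlt; apply/orP; left; apply/eqP; field.
  by rewrite gt_eqF.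
rewrite lee_fin.
have -> : (1 - expR (- ln 2 / 4)) / 768 * (L / n%:R) =
    L / (768 * n%:R) * (1 - expR (- ln 2 / 4)) by field; rewrite gt_eqF.
by rewrite ler_wpM2l//; lra.
Qed.

End lower_bound.

Theorem theorem1 (R : realType) (d : nat) (A : R) :
  (0 < d)%N -> 1 < A ->
  let nu := lebesgue_Rd R d in
  let F := bounded_densities nu A in
  let regime := fun M n : nat =>
    ln (M%:R : R) <= 16 * Num.min 1 (A - 1) ^+ 2 * n%:R in
  let psi := fun n M : nat => ln (M%:R : R) / n%:R in
  optimal_rate_aggregation F F (KL nu) regime psi /\
  achieves_rate F F (KL nu) psi (exp_weights_aggregate nu) /\
  optimal_aggregation_procedure F F (KL nu) regime psi
    (exp_weights_aggregate nu).
Proof.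
move=> d0 A1 nu F regime psi.
have achieves : achieves_rate F F (KL nu) psi (exp_weights_aggregate nu).
  exists 1 => M fs M2 _; have M0 : (0 < M)%N by exact: leq_trans M2.
  exists (exp_weights_estimator fs M0) => //.
  exact: attains_rate_exp_weights.
(* The last conjunct is the conjunction of the other two, and [achieves] is already at hand. *)
suff optimal : optimal_rate_aggregation F F (KL nu) regime psi by [].
split => //.
- by move=> M n M2 n0; rewrite divr_gt0 ?ltr0n// ln_gt0// ltr1n.
- have [C HC] := achieves; exists C => M fs M2 Ffs.
  by have [ftilde _ ?] := HC M fs M2 Ffs; exists ftilde.
(* Positive because [expR (- ln 2 / 4)] is [2^(-1/4)], and free of [M] and [n]. *)
exists ((1 - expR (- ln 2 / 4)) / 768).
  apply: divr_gt0; last by rewrite ltr0n.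
  by rewrite subr_gt0 expR_lt1 mulNr oppr_lt0 divr_gt0// ln_gt0// ltr1n.
move=> M n M2 n0 reg; apply: aggregation_lower_bound => //.
by apply: lebesgue_cells => //; apply/card_gt0P; exists finset.set0.
Qed.
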